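(* Let $p>1$, let $u$ be a smooth solution of $(-\Delta)^3u=|u|^{p-1}u$ in $\mathbb{R}^n$, let $x\in\mathbb{R}^n$, and set $u^\lambda(y)=\lambda^{\frac{6}{p-1}}u(x+\lambda y)$ for $\lambda>0$. Then for all $\lambda>0$ $$\begin{aligned}\frac{dE(\lambda,x,u)}{d\lambda}=&\int_{\partial B_1}\Big(2\lambda^5\big(\tfrac{d^3u^\lambda}{d\lambda^3}\big)^2+(10\delta_1-2\delta_2-56)\lambda^3\big(\tfrac{d^2u^\lambda}{d\lambda^2}\big)^2+(-18\delta_1+6\delta_2-4\delta_3+2\delta_4+72)\lambda\big(\tfrac{du^\lambda}{d\lambda}\big)^2\Big)\\&+\int_{\partial B_1}\Big(4\lambda^3\big|\tfrac{d^2}{d\lambda^2}\nabla_\theta u^\lambda\big|^2+(8\alpha-4\beta+4n-28)\lambda\big|\tfrac{d}{d\lambda}\nabla_\theta u^\lambda\big|^2\Big)\\&+2\lambda\int_{\partial B_1}\big(\tfrac{d}{d\lambda}\Delta_\theta u^\lambda\big)^2+\lambda\int_{\partial B_1}\big(\tfrac{d\,\Delta u^\lambda}{d\lambda}\big)^2 .\end{aligned}$$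
   Context: $B_1$ is the unit ball of $\mathbb{R}^n$ centered at $0$, $B_\lambda(x)$ the ball of radius $\lambda$ centered at $x$; $\nabla_\theta$ and $\Delta_\theta=\mathrm{div}_\theta\nabla_\theta$ are the gradient and Laplace-Beltrami operator of the unit sphere $\partial B_1$; $\Delta u^\lambda$ is the Euclidean Laplacian of $u^\lambda$ in $y$. Put $k=\frac{6}{p-1}$, $\alpha=n-3-2k$, $\beta=k(k+4-n)$, and $\delta_1=2(n-1)-4k$, $\delta_2=6k(1+k)-6k(n-1)+(n-1)(n-3)$, $\delta_3=-4k(1+k)(2+k)+6(n-1)k(1+k)-(n-1)(n-3)(1+2k)$, $\delta_4=k(k+1)(k+2)(k+3)-2(n-1)k(k+1)(k+2)+(n-1)(n-3)k(k+2)$. Write $f=u^\lambda$ and let $'$ denote $\frac{d}{d\lambda}$ at fixed $y$. The functional is $$\begin{aligned}E(\lambda,x,u)=&\ \lambda^{6\frac{p+1}{p-1}-n}\Big(\int_{B_\lambda(x)}\tfrac12|\nabla\Delta u|^2-\tfrac1{p+1}\int_{B_\lambda(x)}|u|^{p+1}\Big)\\&+\int_{\partial B_1}\Big\{\tfrac{k+2}{2}(\Delta u^\lambda)^2-\lambda^5f''''f'+2\lambda^5f'''f''-(\delta_1-6)\lambda^4f'''f'-(24-6\delta_1+\delta_2)\lambda^3f''f'\\&\quad-(9\delta_1-3\delta_2-36)\lambda^2(f')^2+(\delta_1-8)\lambda^4(f'')^2+\delta_4\lambda ff'+2\delta_4f^2\\&\quad+2(\Delta_\theta f)^2+\tfrac12\lambda\tfrac{d}{d\lambda}(\Delta_\theta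 f)^2-4(\beta-n+4)|\nabla_\theta f|^2-(\beta-n+4)\lambda\tfrac{d}{d\lambda}|\nabla_\theta f|^2\\&\quad-6\lambda^2|\nabla_\theta f'|^2+\lambda^3\tfrac{d}{d\lambda}|\nabla_\theta f'|^2\Big\}.\end{aligned}$$ *)

(* Defs.v *)
From HB Require Import structures.
From mathcomp Require Import all_boot all_order all_algebra.
From mathcomp Require Import interval_inference.
From mathcomp Require Import all_classical all_reals all_analysis.
From mathcomp Require Import measurable_realfun.

Set Implicit Arguments.
Unset Strict Implicit.
Unset Printing Implicit Defensive.

Import Order.TTheory GRing.Theory Num.Theory.
Import numFieldNormedType.Exports.

Local Open Scope classical_set_scope.
Local Open Scope ring_scope.

(* The library norm [`|x|] on row vectors is the sup norm: it only provides
   the topology (used for derivatives).  Balls, spheres and lengths of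
   gradients are Euclidean, and use [enorm]. *)

Definition dotv (R : realType) (n : nat) (x y : 'rV[R]_n) : R :=
  \sum_(i < n) x ord0 i * y ord0 i.

Definition enorm (R : realType) (n : nat) (x : 'rV[R]_n) : R :=
  Num.sqrt (dotv x x).

Definition eball (R : realType) (n : nat) (x : 'rV[R]_n) (r : R) :
  set 'rV[R]_n := [set y | enorm (y - x) < r].

Definition usphere (R : realType) (n : nat) : set 'rV[R]_n :=
  [set y | enorm y = 1].

Arguments usphere : clear implicits.

Definition rV_display : measure_display -> measure_display.
Proof. exact. Qed.

Section measurable_rV.
Context (R : realType) (n : nat).

Let coord (i : 'I_n) (x : 'rV[R]_n) : measurableTypeR R := x ord0 i.

Let rV_set0 : g_sigma_preimage coord set0.
Proof. exact: sigma_algebra0. Qed.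

Let rV_setC A : g_sigma_preimage coord A -> g_sigma_preimage coord (~` A).
Proof. exact: sigma_algebraC. Qed.

Let rV_bigcup (F : (set 'rV[R]_n)^nat) :
  (forall i, g_sigma_preimage coord (F i)) ->
  g_sigma_preimage coord (\bigcup_i (F i)).
Proof. exact: sigma_algebra_bigcup. Qed.

(* The sigma-algebra generated by the coordinates, i.e. the Borel one. *)
HB.instance Definition _ := @isMeasurable.Build (rV_display default_measure_display)
  'rV[R]_n (g_sigma_preimage coord) rV_set0 rV_setC rV_bigcup.

End measurable_rV.

Lemma measurable_coord (R : realType) (n : nat) (i : 'I_n) :
  measurable_fun [set: 'rV[R]_n]
    (fun x : 'rV[R]_n => x ord0 i : measurableTypeR R).
Proof.
move=> _ Y mY; rewrite setTI; apply: sub_sigma_algebra => /=.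
rewrite -bigcup_seq/=; exists i => /=; first by rewrite mem_index_enum.
by exists Y => //; rewrite setTI.
Qed.

Lemma measurable_fun_rVP (R : realType) (n : nat) (d : measure_display)
    (T : measurableType d) (f : T -> 'rV[R]_n) :
  (forall i, measurable_fun [set: T]
     (fun t => f t ord0 i : measurableTypeR R)) ->
  measurable_fun [set: T] f.
Proof.
move=> mf _ Y mY; suff : image_set_system setT f measurable Y by [].
move: Y mY; apply: smallest_sub.
  by apply: sigma_algebra_image; apply: sigma_algebra_measurable.
rewrite -bigcup_seq; apply: bigcup_sub => i _ _ [B mB <-].
rewrite /image_set_system/= !setTI.
by have := mf i measurableT _ mB; rewrite setTI.
Qed.

Section lebesgue_rV.
Context (R : realType).

Section step.
Context (n : nat) (m : {sigma_finite_measure set 'rV[R]_n -> \bar R}).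

Definition rV_cons (z : measurableTypeR R * 'rV[R]_n) : 'rV[R]_n.+1 :=
  \row_i (if unlift ord0 i is Some j then z.2 ord0 j else z.1).

Definition rV_uncons (x : 'rV[R]_n.+1) : measurableTypeR R * 'rV[R]_n :=
  (x ord0 ord0, \row_i x ord0 (lift ord0 i)).

Lemma rV_consK : cancel rV_cons rV_uncons.
Proof.
case=> t v; rewrite /rV_uncons /rV_cons/= mxE unlift_none; congr pair.
by apply/rowP => i; rewrite !mxE liftK.
Qed.

Lemma measurable_rV_cons : measurable_fun setT rV_cons.
Proof.
apply: measurable_fun_rVP => i; rewrite /rV_cons.
under eq_fun do rewrite mxE.
case: (unlift _ _) => [j|]; last exact: measurable_fst.
exact: (measurableT_comp (@measurable_coord R n j) measurable_snd).
Qed.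

Lemma measurable_rV_uncons : measurable_fun setT rV_uncons.
Proof.
apply: measurable_fun_pair; first exact: measurable_coord.
apply: measurable_fun_rVP => i; rewrite /rV_uncons/=.
by under eq_fun do rewrite mxE; apply: measurable_coord.
Qed.

Definition lebesgue_step : set 'rV[R]_n.+1 -> \bar R :=
  pushforward (@lebesgue_measure R \x m)%E rV_cons.

Let step0 : lebesgue_step set0 = 0%E.
Proof. by rewrite /lebesgue_step /pushforward preimage_set0 measure0. Qed.

Let step_ge0 A : (0 <= lebesgue_step A)%E.
Proof. by rewrite /lebesgue_step /pushforward; exact: measure_ge0. Qed.

Let step_sigma_additive : semi_sigma_additive lebesgue_step.
Proof.
move=> F mF tF mUF; rewrite /lebesgue_step /pushforward preimage_bigcup.
apply: measure_semi_sigma_additive.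
- move=> k; have := measurable_rV_cons measurableT (mF k).
  by rewrite setTI.
- apply/trivIsetP => /= i j _ _ ij; rewrite -preimage_setI.
  by move/trivIsetP : tF => /(_ _ _ _ _ ij) ->//; rewrite preimage_set0.
- rewrite -preimage_bigcup; have := measurable_rV_cons measurableT mUF.
  by rewrite setTI.
Qed.

HB.instance Definition _ := isMeasure.Build _ _ _ lebesgue_step
  step0 step_ge0 step_sigma_additive.

Let step_sigma_finite : sigma_finite setT lebesgue_step.
Proof.
have /sigma_finiteP[F [TF ndF Foo]] := sigma_finiteT (@lebesgue_measure R).
have /sigma_finiteP[G [TG ndG Goo]] := sigma_finiteT m.
exists (fun k => rV_uncons @^-1` (F k `*` G k)).
  rewrite -preimage_bigcup -[LHS](preimage_setT rV_uncons); congr (_ @^-1` _).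
  apply/esym/seteqP; split => // -[t v] _.
  have [i _ Fit] : (\bigcup_i F i) t by rewrite -TF.
  have [j _ Gjv] : (\bigcup_j G j) v by rewrite -TG.
  exists (maxn i j) => //; split.
  - by move: t Fit; exact/subsetPset/ndF/leq_maxl.
  - by move: v Gjv; exact/subsetPset/ndG/leq_maxr.
move=> k; have [mF Fk] := Foo k; have [mG Gk] := Goo k; split.
  have mFG : measurable (F k `*` G k) by exact: measurableX.
  by have := measurable_rV_uncons measurableT mFG; rewrite setTI.
rewrite /lebesgue_step /pushforward -comp_preimage.
rewrite (_ : _ \o _ = id) ?preimage_id; last first.
  by apply/funext => z /=; rewrite rV_consK.
by rewrite product_measure1E// lte_mul_pinfty// ge0_fin_numE.
Qed.

HB.instance Definition _ := Measure_isSigmaFinite.Build _ _ _ lebesgue_step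
  step_sigma_finite.

End step.

Fixpoint lebesgue_rV (n : nat) : {sigma_finite_measure set 'rV[R]_n -> \bar R} :=
  match n with
  | 0 => dirac (0 : 'rV[R]_0)
  | k.+1 => lebesgue_step (lebesgue_rV k)
  end.

End lebesgue_rV.

Section sphere_measure.
Context (R : realType) (n : nat).

Lemma measurable_enorm :
  measurable_fun [set: 'rV[R]_n] (@enorm R n : _ -> measurableTypeR R).
Proof.
rewrite (_ : @enorm R n = (@powR R ^~ 2^-1) \o (fun x => dotv x x)); last first.
  apply/funext => x; rewrite /= powR12_sqrt//.
  by apply: sumr_ge0 => i _; rewrite -expr2 sqr_ge0.
apply: (@measurableT_comp _ _ _ _ _ _ (@powR R ^~ 2^-1)) => //.
apply: measurable_sum => i.
by apply: measurable_funM; apply: measurable_coord.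
Qed.

Lemma measurable_eball0 (r : R) : measurable (eball (0 : 'rV[R]_n) r).
Proof.
rewrite /eball (_ : mkset _ = (@enorm R n) @^-1` [set` `]-oo, r[]).
  by rewrite -[X in measurable X]setTI; apply: measurable_enorm.
by apply/seteqP; split => y /=; rewrite subr0 in_itv.
Qed.

Definition normalize (y : 'rV[R]_n) : 'rV[R]_n := (enorm y)^-1 *: y.

Lemma measurable_normalize : measurable_fun [set: 'rV[R]_n] normalize.
Proof.
apply: measurable_fun_rVP => i; rewrite /normalize.
under eq_fun do rewrite mxE -powR_inv1 ?sqrtr_ge0//.
have mE := measurable_enorm.
apply: measurable_funM; last exact: measurable_coord.
exact: (@measurableT_comp _ _ _ _ _ _ (@powR R ^~ (-1))).
Qed.

(* The cone measure: [n] times the Lebesgue measure of the part of the unit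
   ball lying above [A].  For [n > 0] and [A] included in the unit sphere this
   is the (n-1)-dimensional surface measure of [A] (the one for which
   integration in polar coordinates holds). *)
Definition sphere_measure (A : set 'rV[R]_n) : \bar R :=
  (n%:R%:E * lebesgue_rV R n (normalize @^-1` A `&` eball 0 1))%E.

Let cone : {measure set 'rV[R]_n -> \bar R} :=
  measure_function_pushforward__canonical__measure_function_Measure
    (mrestr (lebesgue_rV R n) (measurable_eball0 1)) measurable_normalize.

Let sphere0 : sphere_measure set0 = 0%E.
Proof. exact: (measure0 (mscale n%:R%:nng cone)). Qed.

Let sphere_ge0 A : (0 <= sphere_measure A)%E.
Proof. exact: (measure_ge0 (mscale n%:R%:nng cone)). Qed.

Let sphere_sigma_additive : semi_sigma_additive sphere_measure.
Proof.
exact: (@measure_semi_sigma_additive _ _ _ (mscale n%:R%:nng cone)).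
Qed.

HB.instance Definition _ := isMeasure.Build _ _ _ sphere_measure
  sphere0 sphere_ge0 sphere_sigma_additive.

End sphere_measure.

Arguments sphere_measure : clear implicits.

Section operators.
Context (R : realType) (n : nat).
Implicit Types (f u : 'rV[R]_n -> R) (X : 'rV[R]_n -> 'rV[R]_n).

Definition pderiv (i : 'I_n) f (y : 'rV[R]_n) : R := 'D_(delta_mx ord0 i) f y.

(* C^infinity: all iterated partial derivatives are Frechet differentiable. *)
Definition smooth f : Prop :=
  forall (s : seq 'I_n) (y : 'rV[R]_n), differentiable (foldr pderiv f s) y.

Definition grad f (y : 'rV[R]_n) : 'rV[R]_n := \row_i pderiv i f y.

Definition laplacian f (y : 'rV[R]_n) : R := \sum_(i < n) pderiv i (pderiv i f) y.

Definition neg_laplacian f (y : 'rV[R]_n) : R := - laplacian f y.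

(* Operators of the unit sphere, for functions and tangent fields defined
   around it: they are only meaningful for [enorm y = 1], where [sgrad f y] is the orthogonal projection of the ambient
   gradient on the tangent space [y^perp], and [sdiv X y] is the trace of the
   tangential derivative of [X].  The vector fields
   [z |-> e_i - z_i z] involved are tangent to the unit sphere, so that the
   values on the sphere only depend on the restrictions to the sphere, also
   when the operators are composed. *)
Definition sgrad f (y : 'rV[R]_n) : 'rV[R]_n :=
  grad f y - dotv (grad f y) y *: y.

Definition sdiv X (y : 'rV[R]_n) : R :=
  \sum_(i < n) sgrad (fun z => X z ord0 i) y ord0 i.

Definition slaplacian f : 'rV[R]_n -> R := sdiv (sgrad f).

End operators.

Section energy.
Context (R : realType) (n : nat) (p : R).

Definition kexp : R := 6 / (p - 1).

Local Notation k := kexp.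
Local Notation N := (n%:R : R).

Definition alpha : R := N - 3 - 2 * k.
Definition beta : R := k * (k + 4 - N).
Definition delta1 : R := 2 * (N - 1) - 4 * k.
Definition delta2 : R :=
  6 * k * (1 + k) - 6 * k * (N - 1) + (N - 1) * (N - 3).
Definition delta3 : R :=
  - 4 * k * (1 + k) * (2 + k) + 6 * (N - 1) * k * (1 + k)
  - (N - 1) * (N - 3) * (1 + 2 * k).
Definition delta4 : R :=
  k * (k + 1) * (k + 2) * (k + 3) - 2 * (N - 1) * k * (k + 1) * (k + 2)
  + (N - 1) * (N - 3) * k * (k + 2).

Variables (u : 'rV[R]_n -> R) (x : 'rV[R]_n).

Definition scaled (l : R) (y : 'rV[R]_n) : R :=
  l `^ (6 / (p - 1)) * u (x + l *: y).

Definition dscaled (m : nat) (l : R) (y : 'rV[R]_n) : R :=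
  derive1n m (fun t => scaled t y) l.

Definition energy_boundary (l : R) (y : 'rV[R]_n) : R :=
  let f m := dscaled m l y in
    (k + 2) / 2 * laplacian (scaled l) y ^+ 2
  - l ^+ 5 * f 4 * f 1
  + 2 * l ^+ 5 * f 3 * f 2
  - (delta1 - 6) * l ^+ 4 * f 3 * f 1
  - (24 - 6 * delta1 + delta2) * l ^+ 3 * f 2 * f 1
  - (9 * delta1 - 3 * delta2 - 36) * l ^+ 2 * f 1 ^+ 2
  + (delta1 - 8) * l ^+ 4 * f 2 ^+ 2
  + delta4 * l * f 0 * f 1
  + 2 * delta4 * f 0 ^+ 2
  + 2 * slaplacian (scaled l) y ^+ 2
  + 2^-1 * l * derive1 (fun t => slaplacian (scaled t) y ^+ 2) l
  - 4 * (beta - N + 4) * enorm (sgrad (scaled l) y) ^+ 2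
  - (beta - N + 4) * l * derive1 (fun t => enorm (sgrad (scaled t) y) ^+ 2) l
  - 6 * l ^+ 2 * enorm (sgrad (dscaled 1 l) y) ^+ 2
  + l ^+ 3 * derive1 (fun t => enorm (sgrad (dscaled 1 t) y) ^+ 2) l.

Definition energy (l : R) : R :=
  l `^ (6 * ((p + 1) / (p - 1)) - N) *
    (\int[lebesgue_rV R n]_(y in eball x l)
        (2^-1 * enorm (grad (laplacian u) y) ^+ 2)
     - (p + 1)^-1 * \int[lebesgue_rV R n]_(y in eball x l)
        (`|u y| `^ (p + 1)))
  + \int[sphere_measure R n]_(y in usphere R n) energy_boundary l y.

End energy.

(* Main.v *)
(** With [v z = u (x + z)] and [k = 6 / (p - 1)], [u^l (y) = l ^ k v (l y)], and its [m]-th derivative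
    in [l] is [l ^ (k - m) V_m (l y)] with [V_0 = v], [V_(m+1) = (k - m) V_m + D V_m], [D] being the
    Euler field.  On the unit sphere the boundary integrand of the energy is therefore
    [l ^ (2k) h (l y)] for one smooth function [h], and [l d/dl] acts on it as [2k + D] on [h].
    By the equation, the same operation turns the bulk density into the divergence of an explicit
    flux, hence into a boundary term.  Everything is then a quadratic expression in the [V_m], in
    which the Laplacian is [D D + (n - 2) D + L] with [L] the spherical Laplacian; the difference
    with the claimed dissipation is a combination of the integrands of Green's formula on the sphere.

    The surface measure being defined by cones, the formula
    [int_(sphere) f = int_(ball) (n f + D f)] comes from differentiating [int_(ball of radius s)] of
    [f - f (y / |y|)] at [s = 1], which vanishes to second order there.  The divergence theorem on
    the ball reduces to it algebraically once it is known for fields with a factor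
    [(1 - |y|^2)^2], where it is the translation invariance of the Lebesgue measure. *)
Require Import Defs.
From HB Require Import structures.
From mathcomp Require Import all_boot all_order all_algebra.
From mathcomp Require Import all_classical all_reals all_analysis.
From mathcomp Require Import measurable_realfun ring lra.

Import Order.TTheory GRing.Theory Num.Theory.
Import numFieldNormedType.Exports.

Local Open Scope classical_set_scope.
Local Open Scope ring_scope.

Set Implicit Arguments.
Unset Strict Implicit.
Unset Printing Implicit Defensive.

(** * Smooth functions *)

(** Smooth functions are bundled into a commutative ring [sfn], so that differential identities
    become polynomial ones, decided by [ring]. The spherical operators are replaced by [angL] and
    [angG], and the Laplacian by [nlap]. Thanks to a factor [rho2] these are defined on the whole
    space, are invariant under dilations, and agree with the original operators on the unit sphere;
    no chart of the sphere is needed. On the analytic side, the obstacle is that neither integration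
    by parts on the ball nor integration by parts on the sphere is given: both have to come from
    dilations and translations of Lebesgue measure. The exponent in (1 - |y|^2)^2 is the one for
    which the extension by zero is still differentiable everywhere. The factor is then removed one
    power at a time: the identity already known is applied to a combination of the field and its
    Euler derivative, with a constant chosen so that the unwanted terms have the form n f + D f,
    hence are integrals over the sphere, where 1 - |y|^2 vanishes. *)

Section smooth_closure.
Context (R : realType) (n : nat).
Implicit Types (f g : 'rV[R]_n -> R) (i j : 'I_n).

Lemma smooth_pderiv i f : smooth f -> smooth (pderiv i f).
Proof. by move=> sf s y; have := sf (rcons s i) y; rewrite foldr_rcons. Qed.

Lemma smooth_differentiable f y : smooth f -> differentiable f y.
Proof. by move=> /(_ [::] y). Qed.

Lemma smooth_continuous f : smooth f -> continuous f.
Proof. by move=> sf y; exact/differentiable_continuous/smooth_differentiable. Qed.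

(** Induction on the order is what the product rule needs: differentiating [f * g] gives a sum of
    two products of lower order, which does not fit an induction on the list of derivatives in
    [smooth]. *)
Fixpoint smoothn (m : nat) f : Prop :=
  (forall y, differentiable f y) /\
  if m is k.+1 then forall i, smoothn k (pderiv i f) else True.

Lemma smoothnP f : smooth f <-> forall m, smoothn m f.
Proof.
split=> [sf m|sf s].
  elim: m f sf => [|m IH] f sf; first by split=> //; exact: (sf [::]).
  by split=> [|i]; [exact: (sf [::])|apply/IH/smooth_pderiv].
have {sf} := sf (size s); elim/last_ind: s f => [|s i IH] f; first by case.
by rewrite size_rcons foldr_rcons => -[_ /(_ i)]; exact: IH.
Qed.

Lemma smoothnW m f : smoothn m.+1 f -> smoothn m f.
Proof.
elim: m f => [|m IH] f [df sf]; split => // i.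
by apply: IH; exact: sf.
Qed.

Lemma pderivD i f g : (forall y, differentiable f y) ->
  (forall y, differentiable g y) -> pderiv i (f + g) = pderiv i f + pderiv i g.
Proof.
by move=> df dg; apply/funext => y; rewrite /pderiv deriveD//;
  exact: diff_derivable.
Qed.

Lemma pderivN i f : (forall y, differentiable f y) ->
  pderiv i (- f) = - pderiv i f.
Proof.
by move=> df; apply/funext => y; rewrite /pderiv deriveN//; exact: diff_derivable.
Qed.

Lemma pderivM i f g : (forall y, differentiable f y) ->
  (forall y, differentiable g y) ->
  pderiv i (f * g) = pderiv i f * g + f * pderiv i g.
Proof.
move=> df dg; apply/funext => y; rewrite /pderiv deriveM; try exact: diff_derivable.
rewrite /GRing.scale/= addrC.
by congr (_ + _); rewrite mulrC.
Qed.

Lemma pderiv_cst i (c : R) : pderiv i (cst c) = cst 0.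
Proof. by apply/funext => y; rewrite /pderiv derive_cst. Qed.

Lemma pderiv_coord i j :
  pderiv i (fun y : 'rV[R]_n => y ord0 j) = cst (i == j)%:R.
Proof.
apply/funext => y; rewrite /pderiv /=.
have := derive_mx (@derivable_id _ _ y (delta_mx ord0 i)).
rewrite derive_id => /matrixP/(_ ord0 j); rewrite !mxE eqxx/= => H.
by rewrite [i == j]eq_sym; exact: esym H.
Qed.

Lemma smoothnD m f g : smoothn m f -> smoothn m g -> smoothn m (f + g).
Proof.
elim: m f g => [|m IH] f g [df sf] [dg sg].
  by split=> // y; exact: differentiableD.
split=> [y|i]; first exact: differentiableD.
by rewrite pderivD//; exact: (IH _ _ (sf i) (sg i)).
Qed.

Lemma smoothnM m f g : smoothn m f -> smoothn m g -> smoothn m (f * g).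
Proof.
elim: m f g => [|m IH] f g.
  by move=> [df _] [dg _]; split=> // y; exact: differentiableM.
move=> sf sg; have [[df sf'] [dg sg']] := (sf, sg); split=> [y|i].
  exact: differentiableM.
rewrite pderivM//; apply: smoothnD.
- by apply: IH; [exact: sf'|exact: smoothnW].
- by apply: IH; [exact: smoothnW|exact: sg'].
Qed.

Lemma smoothD f g : smooth f -> smooth g -> smooth (f + g).
Proof. by move=> /smoothnP sf /smoothnP sg; apply/smoothnP=> m; exact: smoothnD. Qed.

Lemma smoothM f g : smooth f -> smooth g -> smooth (f * g).
Proof. by move=> /smoothnP sf /smoothnP sg; apply/smoothnP=> m; exact: smoothnM. Qed.

Lemma smooth_cst (c : R) : smooth (cst c : 'rV[R]_n -> R).
Proof.
apply/smoothnP=> m; elim: m c => [|m IH] c; first by split.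
by split=> // i; rewrite pderiv_cst; exact: IH.
Qed.

Lemma smooth_coord j : smooth (fun y : 'rV[R]_n => y ord0 j).
Proof.
apply/smoothnP=> m; case: m => [|m].
  by split=> // y; exact: differentiable_coord.
split=> [y|i]; first exact: differentiable_coord.
by rewrite pderiv_coord; move: m; apply/smoothnP/smooth_cst.
Qed.

Lemma smoothN f : smooth f -> smooth (- f).
Proof.
move=> sf; have -> : - f = cst (-1) * f.
  by apply/funext => y; rewrite /GRing.mul/= mulN1r.
by apply: smoothM => //; exact: smooth_cst.
Qed.

Lemma differentiable_affine (a : R) (x y : 'rV[R]_n) f :
  differentiable f (x + a *: y) -> differentiable (fun z => f (x + a *: z)) y.
Proof.
move=> df; apply: (@differentiable_comp _ _ _ _ (fun z => x + a *: z) f) => //.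
Qed.

Lemma pderiv_affine i (a : R) (x : 'rV[R]_n) f : (forall y, differentiable f y) ->
  pderiv i (fun z => f (x + a *: z)) =
  cst a * (fun z => pderiv i f (x + a *: z)).
Proof.
move=> df; apply/funext => y; rewrite /pderiv.
have d1 : differentiable (fun z : 'rV[R]_n => x + a *: z) y.
  by [].
rewrite !deriveE//; last exact: differentiable_affine.
rewrite (@diff_comp _ _ _ _ (fun z => x + a *: z) f)//=.
have -> : 'd (fun z : 'rV[R]_n => x + a *: z) y (delta_mx ord0 i)
    = a *: delta_mx ord0 i.
  rewrite -deriveE// deriveD//.
    by rewrite derive_cst add0r deriveZ// derive_id.

by rewrite linearZ/= -deriveE.
Qed.

Lemma smooth_affine (a : R) (x : 'rV[R]_n) f :
  smooth f -> smooth (fun z => f (x + a *: z)).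
Proof.
move=> sf; apply/smoothnP=> m; elim: m f sf => [|m IH] f sf.
  by split=> // y; exact/differentiable_affine/smooth_differentiable.
split=> [y|i]; first exact/differentiable_affine/smooth_differentiable.
 rewrite pderiv_affine; last by move=> y; exact: smooth_differentiable.
apply: smoothnM; first by move: m {IH}; apply/smoothnP/smooth_cst.
by apply: IH; exact: smooth_pderiv.
Qed.

Lemma derive_sum_pderiv f (y v : 'rV[R]_n) : differentiable f y ->
  'D_v f y = \sum_i v ord0 i * pderiv i f y.
Proof.
move=> df; rewrite deriveE// {1}(row_sum_delta v) linear_sum/=.
by apply: eq_bigr => i _; rewrite linearZ/= /pderiv deriveE.
Qed.

Lemma is_derive_line f (y v : 'rV[R]_n) (t : R) :
  differentiable f (y + t *: v) ->
  is_derive t 1 (fun s => f (y + s *: v)) ('D_v f (y + t *: v)).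
Proof.
move=> df; have {df} dfv : derivable f (y + t *: v) v by exact: diff_derivable.
have E : (fun h : R => h^-1 *: (f (y + (h *: (1 : R) + t) *: v) - f (y + t *: v)))
    = (fun h => h^-1 *: (f (h *: v + (y + t *: v)) - f (y + t *: v))).
  apply/funext => h; congr (_ *: (f _ - _)).
  by have -> : h *: (1 : R) = h by [exact: mulr1]; rewrite scalerDl addrCA.
by apply: DeriveDef; rewrite /derivable /derive /= E.
Qed.

Lemma is_derive_pderiv_line f i (y : 'rV[R]_n) (t : R) : smooth f ->
  is_derive t 1 (fun s => f (y + s *: delta_mx ord0 i))
    (pderiv i f (y + t *: delta_mx ord0 i)).
Proof. by move=> sf; apply: is_derive_line; exact: smooth_differentiable. Qed.

Lemma is_derive_within_continuous (f df : R -> R) (a b : R) :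
  (forall t : R, is_derive t 1 f (df t)) -> {within `[a, b], continuous f}.
Proof.
move=> H; apply: derivable_within_continuous => t _.
exact: (@ex_derive _ _ _ _ _ _ _ (H t)).
Qed.

(** Mean value theorem twice: along [e i] for the difference of [f] on two parallel lines, then
    along [e j] for its derivative. The left-hand side is symmetric in [i] and [j], whence
    [pderivC]. *)
Lemma second_difference f i j (y : 'rV[R]_n) (h : R) : smooth f -> 0 < h ->
  let e k : 'rV[R]_n := delta_mx ord0 k in
  exists t s, [/\ 0 <= t <= h, 0 <= s <= h &
    f (y + h *: e i + h *: e j) - f (y + h *: e i) - f (y + h *: e j) + f y =
    h ^+ 2 * pderiv j (pderiv i f) (y + t *: e i + s *: e j)].
Proof.
move=> sf h0 e.
pose phi t := f (y + h *: e j + t *: e i) - f (y + t *: e i).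
pose dphi t := pderiv i f (y + h *: e j + t *: e i) - pderiv i f (y + t *: e i).
have dphiE (t : R) : is_derive t 1 phi (dphi t).
  by apply: is_deriveB; exact: is_derive_pderiv_line.
have [t ht pE] := @MVT_segment _ phi dphi 0 h (ltW h0) (fun t _ => dphiE t)
  (is_derive_within_continuous dphiE).
pose psi s := pderiv i f (y + t *: e i + s *: e j).
have dpsi (s : R) : is_derive s 1 psi (pderiv j (pderiv i f) (y + t *: e i + s *: e j)).
  by apply: is_derive_pderiv_line; exact: smooth_pderiv.
have [s hs sE] := MVT_segment (ltW h0) (fun t _ => dpsi t)
  (is_derive_within_continuous dpsi).
exists t, s; split; [by move: ht; rewrite in_itv|by move: hs; rewrite in_itv|].
have {pE} pE : phi h - phi 0 = dphi t * h by rewrite pE subr0.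
have {sE} sE : dphi t = pderiv j (pderiv i f) (y + t *: e i + s *: e j) * h.
  by rewrite -[X in _ * X]subr0 -sE /psi /dphi scale0r addr0 addrAC.
rewrite sE /phi scale0r !addr0 in pE.
have -> : h ^+ 2 * pderiv j (pderiv i f) (y + t *: e i + s *: e j)
    = pderiv j (pderiv i f) (y + t *: e i + s *: e j) * h * h.
  by move: (pderiv j _ _) => D; ring.
rewrite -pE [y + h *: e i + _]addrAC.
move: (f _) (f _) (f _) (f _) => a b c d.
by rewrite opprB addrA [RHS]addrAC.
Qed.

(** If the two values at [y] differed, continuity would keep each mixed derivative within half their
    distance of its own value near [y]; but the second difference is [h ^+ 2] times a nearby value
    of either one. *)
Lemma pderivC f i j : smooth f -> pderiv i (pderiv j f) = pderiv j (pderiv i f).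
Proof.
move=> sf; apply/funext => y; apply/eqP/negPn/negP => neq.
set a := pderiv i _ y in neq; set b := pderiv j _ y in neq.
have d0 : 0 < `|a - b| / 2 by rewrite divr_gt0// normr_gt0 subr_eq0.
have ci := @smooth_continuous _ (smooth_pderiv (i) (smooth_pderiv (j) sf)) y.
have cj := @smooth_continuous _ (smooth_pderiv j (smooth_pderiv i sf)) y.
move/cvgrPdist_lt : ci => /(_ _ d0) ci; move/cvgrPdist_lt : cj => /(_ _ d0) cj.
have [r /= r0 H] := (nbhs_ballP y _).1 (filterI ci cj).
(* Two displacements of length at most [r / 3] do not leave the ball of radius [r]. *)
pose h := r / 3; have h0 : 0 < h by rewrite divr_gt0.
have inb (t s : R) (k l : 'I_n) : 0 <= t <= h -> 0 <= s <= h ->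
    ball y r (y + t *: delta_mx ord0 k + s *: delta_mx ord0 l).
  move=> /andP[t0 th] /andP[s0 sh]; rewrite -ball_normE /ball_/=.
  rewrite -addrA opprD addNKr normrN (le_lt_trans (ler_normD _ _))// !normrZ.
  have nd (m : 'I_n) : `|delta_mx ord0 m : 'rV[R]_n| <= 1.
    rewrite [leLHS]/Num.norm/= mx_normrE; apply: bigmax_le => // -[u v] _ /=.
    by rewrite mxE; case: (_ && _) => /=; rewrite ?normr0 ?normr1.
  rewrite (@le_lt_trans _ _ (t * 1 + s * 1))// ?lerD ?ger0_norm ?ler_wpM2l//.
  by rewrite !mulr1 (le_lt_trans (lerD th sh))// /h; lra.
have [t [s [t1 s1 E1]]] := second_difference i j y sf h0.
have [t' [s' [t2 s2 E2]]] := second_difference j i y sf h0.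
have /H[_ /=] := inb _ _ i j t1 s1; have /H[/= + _] := inb _ _ j i t2 s2.
have -> : pderiv i (pderiv j f) (y + t' *: delta_mx ord0 j + s' *: delta_mx ord0 i)
  = pderiv j (pderiv i f) (y + t *: delta_mx ord0 i + s *: delta_mx ord0 j).
  apply: (mulfI (_ : h ^+ 2 != 0)); first by rewrite expf_neq0// gt_eqF.
  refine (etrans (esym E2) (etrans _ E1)).
  have -> : y + h *: delta_mx ord0 j + h *: delta_mx ord0 i =
    y + h *: delta_mx ord0 i + h *: delta_mx ord0 j by exact: addrAC.
  by congr (_ + _); exact: addrAC.
rewrite -/a -/b; move: (pderiv j (pderiv i f) (_ + _)) a b {neq d0 ci cj H E1 E2}.
move=> c a b H1 H2; suff : `|a - b| < `|a - b| by rewrite ltxx.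
rewrite (le_lt_trans (ler_distD c a b))// [`|c - b|]distrC.
by rewrite [ltRHS]splitr ltrD.
Qed.

End smooth_closure.

(** * The commutative ring of smooth functions and its derivations *)

Section sfn_def.
Context (R : realType) (n : nat).

Definition smoothp : {pred 'rV[R]_n -> R} := mem [set f | smooth f].
Definition smoothp_key : pred_key smoothp. Proof. exact. Qed.
Canonical smoothp_keyed := KeyedPred smoothp_key.

Record sfn := Sfn { sfn_val :> 'rV[R]_n -> R; _ : sfn_val \in smoothp }.

HB.instance Definition _ := [isSub for sfn_val].
HB.instance Definition _ := [Choice of sfn by <:].

Lemma smooth_sfn (f : sfn) : smooth f.
Proof. by case: f => f /=; rewrite inE. Qed.

Definition mksfn f (sf : smooth f) : sfn := Sfn (mem_set sf).

Lemma smoothp_subring_closed : subring_closed smoothp.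
Proof.
split=> [|f g|f g]; rewrite !inE/=; first exact: smooth_cst.
- by move=> sf sg; apply: smoothD => //; exact: smoothN.
- exact: smoothM.
Qed.

HB.instance Definition _ := GRing.isSubringClosed.Build _ smoothp
  smoothp_subring_closed.
HB.instance Definition _ := [SubChoice_isSubComNzRing of sfn by <:].

Lemma sfnP (f g : sfn) : (forall y, f y = g y) <-> f = g.
Proof. by split=> [fg|->//]; apply/val_inj/funext. Qed.

Lemma sfnDE (f g : sfn) y : (f + g) y = f y + g y. Proof. by []. Qed.
Lemma sfnBE (f g : sfn) y : (f - g) y = f y - g y. Proof. by []. Qed.
Lemma sfnNE (f : sfn) y : (- f) y = - f y. Proof. by []. Qed.
Lemma sfnME (f g : sfn) y : (f * g) y = f y * g y. Proof. by []. Qed.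
Lemma sfn1E y : (1 : sfn) y = 1. Proof. by []. Qed.
Lemma sfnXE (f : sfn) m y : (f ^+ m) y = f y ^+ m.
Proof. by elim: m => [|m IH]; rewrite ?expr0// !exprS sfnME IH. Qed.
Lemma sfnMnE (f : sfn) m y : (f *+ m) y = f y *+ m.
Proof. by elim: m => [|m IH]; rewrite ?mulr0n// !mulrS sfnDE IH. Qed.
Lemma sfn_sumE I (r : seq I) (P : pred I) (F : I -> sfn) y :
  (\sum_(i <- r | P i) F i) y = \sum_(i <- r | P i) F i y.
Proof. by elim/big_rec2: _ => [//|i a b _ <-]; rewrite sfnDE. Qed.

Definition cstf (c : R) : sfn := mksfn (@smooth_cst R n c).
Definition xcoord (i : 'I_n) : sfn := mksfn (@smooth_coord R n i).

Lemma const_is_additive : additive cstf.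
Proof. by move=> a b; apply/sfnP => y. Qed.
Lemma const_is_multiplicative : multiplicative cstf.
Proof. by split=> [a b|]; apply/sfnP => y. Qed.
HB.instance Definition _ := GRing.isZmodMorphism.Build R sfn cstf const_is_additive.
HB.instance Definition _ := GRing.isMonoidMorphism.Build R sfn cstf
  (const_is_multiplicative.2, const_is_multiplicative.1).

Definition pd (i : 'I_n) (f : sfn) : sfn := mksfn (smooth_pderiv i (smooth_sfn f)).

Lemma sfn_differentiable (f : sfn) y : differentiable f y.
Proof. exact/smooth_differentiable/smooth_sfn. Qed.


#[local] Hint Resolve sfn_differentiable : core.

Lemma pd_is_additive i : additive (pd i).
Proof.
move=> f g; apply/val_inj; rewrite /= pderivD ?pderivN//.
by move=> y; exact: differentiableN.
Qed.
HB.instance Definition _ i := GRing.isZmodMorphism.Build sfn sfn (pd i) (pd_is_additive i).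

Lemma pdM i (f g : sfn) : pd i (f * g) = pd i f * g + f * pd i g.
Proof. by apply/val_inj; rewrite /= pderivM. Qed.

Lemma pd_const i c : pd i (cstf c) = 0.
Proof. by apply/val_inj; rewrite /= pderiv_cst. Qed.

Lemma pd_coord i j : pd i (xcoord j) = (i == j)%:R.
Proof. by apply/sfnP => y; rewrite /= pderiv_coord sfnMnE. Qed.

Lemma pdC i j f : pd i (pd j f) = pd j (pd i f).
Proof. by apply/val_inj; rewrite /= pderivC//; exact: smooth_sfn. Qed.

End sfn_def.
Arguments cstf {R n}.
Arguments xcoord {R n}.

(** * Commutation rules for the Euler field, the Laplacian and the angular operators *)

Section operators.
Context (R : realType) (n : nat).
Local Notation sfn := (sfn R n).
Implicit Types (f g : sfn).
Local Notation N := (n%:R : sfn).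
Local Notation X := (@xcoord R n).

Definition euler f : sfn := \sum_(i < n) X i * pd i f.
Definition lap f : sfn := \sum_(i < n) pd i (pd i f).
Definition rho2 : sfn := \sum_(i < n) X i ^+ 2.
Definition gdot f g : sfn := \sum_(i < n) pd i f * pd i g.
Definition div (F : 'I_n -> sfn) : sfn := \sum_(i < n) pd i (F i).
Definition radial (F : 'I_n -> sfn) : sfn := \sum_(i < n) X i * F i.
(* On the unit sphere [angL] is the Laplace-Beltrami operator and [angG] is the
   product of the tangential gradients. *)
Definition angL f : sfn :=
  rho2 * lap f - euler (euler f) - (N - 2) * euler f.
Definition angG f g : sfn := rho2 * gdot f g - euler f * euler g.
(** The Laplacian normalised to degree 0: it commutes with [euler] and with dilations, and equals
    [lap f] on the unit sphere. *)
Definition nlap f : sfn := rho2 * lap f.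

Lemma euler_is_additive : additive euler.
Proof.
move=> f g; rewrite /euler -sumrB; apply: eq_bigr => i _.
by rewrite raddfB mulrBr.
Qed.
HB.instance Definition _ := GRing.isZmodMorphism.Build sfn sfn euler euler_is_additive.

Lemma lap_is_additive : additive lap.
Proof. by move=> f g; rewrite /lap -sumrB; apply: eq_bigr => i _; rewrite !raddfB. Qed.
HB.instance Definition _ := GRing.isZmodMorphism.Build sfn sfn lap lap_is_additive.

Lemma angL_is_additive : additive angL.
Proof. by move=> f g; rewrite /angL !raddfB/=; ring. Qed.
HB.instance Definition _ := GRing.isZmodMorphism.Build sfn sfn angL angL_is_additive.

Lemma pd_nat i (m : nat) : pd i (m%:R : sfn) = 0.
Proof. by rewrite -(rmorph_nat (@cstf R n)) pd_const. Qed.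

Lemma pdD i f g : pd i (f + g) = pd i f + pd i g. Proof. exact: raddfD. Qed.
Lemma pdB i f g : pd i (f - g) = pd i f - pd i g. Proof. exact: raddfB. Qed.
Lemma eulerD f g : euler (f + g) = euler f + euler g. Proof. exact: raddfD. Qed.
Lemma eulerB f g : euler (f - g) = euler f - euler g. Proof. exact: raddfB. Qed.

Lemma pd1 i : pd i (1 : sfn) = 0.
Proof. exact: (pd_nat i 1). Qed.

Lemma eulerM f g : euler (f * g) = euler f * g + f * euler g.
Proof.
rewrite /euler mulr_suml mulr_sumr -big_split/=; apply: eq_bigr => i _.
by rewrite pdM; ring.
Qed.

Lemma euler_const c : euler (cstf c) = 0.
Proof. by rewrite /euler big1// => i _; rewrite pd_const mulr0. Qed.

Lemma euler_nat (m : nat) : euler (m%:R : sfn) = 0.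
Proof. by rewrite -(rmorph_nat (@cstf R n)) euler_const. Qed.

Lemma euler1 : euler (1 : sfn) = 0.
Proof. exact: (euler_nat 1). Qed.

Lemma euler_coord i : euler (X i) = X i.
Proof.
rewrite /euler (bigD1 i)//= pd_coord eqxx mulr1 big1 ?addr0// => j ji.
by rewrite pd_coord (negPf ji) mulr0.
Qed.

Lemma euler_sum (F : 'I_n -> sfn) : euler (\sum_i F i) = \sum_i euler (F i).
Proof. exact: raddf_sum. Qed.

Lemma pd_euler i f : pd i (euler f) = pd i f + euler (pd i f).
Proof.
rewrite {1}/euler raddf_sum/=.
under eq_bigr => j _ do rewrite pdM pd_coord pdC.
rewrite big_split/=; congr (_ + _).
rewrite (bigD1 i)//= eqxx mul1r big1 ?addr0// => j ji.
by rewrite eq_sym (negPf ji) mul0r.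
Qed.

Lemma lap_euler f : lap (euler f) = 2 * lap f + euler (lap f).
Proof.
rewrite {2 3}/lap euler_sum mulr_sumr -big_split; apply: eq_bigr => i _.
by rewrite /= pd_euler raddfD/= pd_euler; ring.
Qed.

Lemma euler_rho2 : euler rho2 = 2 * rho2.
Proof.
rewrite /rho2 euler_sum mulr_sumr; apply: eq_bigr => i _.
by rewrite expr2 eulerM euler_coord; ring.
Qed.

Lemma pd_rho2 i : pd i rho2 = 2 * X i.
Proof.
rewrite /rho2 raddf_sum/= (bigD1 i)//= big1 ?addr0 => [|j ji].
  by rewrite expr2 pdM pd_coord eqxx mulr1n; ring.
by rewrite expr2 pdM pd_coord eq_sym (negPf ji) mulr0n; ring.
Qed.

Lemma lapM f g : lap (f * g) = lap f * g + 2 * gdot f g + f * lap g.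
Proof.
rewrite /lap mulr_suml /gdot !mulr_sumr -!big_split.
by apply: eq_bigr => i _; rewrite /= !pdM raddfD/= !pdM; ring.
Qed.

Lemma lap_rho2 : lap rho2 = 2 * N.
Proof.
rewrite /lap (eq_bigr (fun=> 2%:R)) => [|i _].
  by rewrite sumr_const card_ord mulr_natr.
by rewrite pd_rho2 pdM pd_nat pd_coord eqxx mul0r add0r mulr1.
Qed.

Lemma gdot_rho2 f : gdot rho2 f = 2 * euler f.
Proof.
rewrite /gdot /euler mulr_sumr; apply: eq_bigr => i _.
by rewrite pd_rho2 mulrA.
Qed.

Lemma gdotC f g : gdot f g = gdot g f.
Proof. by apply: eq_bigr => i _; rewrite mulrC. Qed.

Lemma euler_gdot f g :
  euler (gdot f g) = gdot (euler f) g + gdot f (euler g) - 2 * gdot f g.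
Proof.
rewrite /gdot euler_sum mulr_sumr -big_split/= -sumrB; apply: eq_bigr => i _.
by rewrite eulerM !pd_euler; ring.
Qed.

Lemma euler_angG f g : euler (angG f g) = angG (euler f) g + angG f (euler g).
Proof. by rewrite /angG raddfB/= !eulerM euler_rho2 euler_gdot; ring. Qed.

Lemma angGC f g : angG f g = angG g f.
Proof. by rewrite /angG gdotC [euler f * _]mulrC. Qed.

(** [angL] has degree 0: the factor [rho2] compensates the two orders lost in [lap]. *)
Lemma euler_angL f : euler (angL f) = angL (euler f).
Proof.
rewrite /angL !raddfB/= !eulerM euler_rho2 lap_euler !raddfB/= !euler_nat.
ring.
Qed.

(** [angL] only differentiates along the spheres centred at 0, on which [rho2] is constant. *)
Lemma angL_rho2 f : angL (rho2 * f) = rho2 * angL f.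
Proof.
rewrite /angL lapM lap_rho2 gdot_rho2 !eulerM euler_rho2.
rewrite raddfD/= !eulerM euler_rho2 euler_nat; ring.
Qed.

Lemma euler_angLE f : nlap f = euler (euler f) + (N - 2) * euler f + angL f.
Proof. by rewrite /nlap /angL; ring. Qed.

Lemma euler_nlap f : euler (nlap f) = nlap (euler f).
Proof. by rewrite /nlap eulerM euler_rho2 lap_euler; ring. Qed.

Lemma divM f (F : 'I_n -> sfn) :
  div (fun i => f * F i) = \sum_(i < n) pd i f * F i + f * div F.
Proof.
rewrite /div mulr_sumr -big_split; apply: eq_bigr => i _.
by rewrite /= pdM.
Qed.

Lemma div_euler (F : 'I_n -> sfn) :
  div (fun i => euler (F i)) = div F + euler (div F).
Proof.
by rewrite /div euler_sum -big_split; apply: eq_bigr => i _; exact: pd_euler.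
Qed.

Lemma euler_radial (F : 'I_n -> sfn) :
  euler (radial F) = radial F + radial (fun i => euler (F i)).
Proof.
rewrite /radial euler_sum -big_split; apply: eq_bigr => i _.
by rewrite /= eulerM euler_coord.
Qed.

End operators.

(** * Action of dilations on the operators *)

Section dilation.
Context (R : realType) (n : nat).
Local Notation sfn := (sfn R n).
Implicit Types (f g : sfn) (t : R).

Lemma smooth_dilation t f : smooth (fun y : 'rV[R]_n => f (t *: y)).
Proof.
have := smooth_affine t 0 (smooth_sfn f).
by under eq_fun do rewrite add0r.
Qed.

Definition dil t f : sfn := mksfn (smooth_dilation t f).

Lemma dilE t f y : dil t f y = f (t *: y). Proof. by []. Qed.

Lemma dil_is_additive t : additive (dil t).
Proof. by move=> f g; apply/sfnP. Qed.
Lemma dil_is_multiplicative t : multiplicative (dil t).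
Proof. by split=> [f g|]; apply/sfnP. Qed.
HB.instance Definition _ t := GRing.isZmodMorphism.Build sfn sfn (dil t) (dil_is_additive t).
HB.instance Definition _ t := GRing.isMonoidMorphism.Build sfn sfn (dil t)
  ((dil_is_multiplicative t).2, (dil_is_multiplicative t).1).

Lemma dil_const t c : dil t (cstf c) = cstf c. Proof. exact/sfnP. Qed.

Lemma dil_coord t i : dil t (xcoord i) = cstf t * xcoord i.
Proof. by apply/sfnP => y; rewrite /= mxE. Qed.

Lemma pd_dil t i f : pd i (dil t f) = cstf t * dil t (pd i f).
Proof.
apply/sfnP => y /=; have := pderiv_affine i t 0 (sfn_differentiable f).
under eq_fun do rewrite add0r.
by move=> ->; rewrite /GRing.mul/= add0r.
Qed.

Lemma euler_dil t f : euler (dil t f) = dil t (euler f).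
Proof.
rewrite /euler raddf_sum; apply: eq_bigr => i _.
by rewrite pd_dil /= rmorphM/= dil_coord; ring.
Qed.

Lemma dil_rho2 t : dil t (@rho2 R n) = cstf t ^+ 2 * @rho2 R n.
Proof.
rewrite /rho2 raddf_sum mulr_sumr; apply: eq_bigr => i _.
by rewrite /= rmorphXn/= dil_coord exprMn.
Qed.

Lemma lap_dil t f : lap (dil t f) = cstf t ^+ 2 * dil t (lap f).
Proof.
rewrite /lap raddf_sum mulr_sumr; apply: eq_bigr => i _.
rewrite pd_dil pdM pd_const mul0r add0r pd_dil/=; ring.
Qed.

Lemma angL_dil t f : angL (dil t f) = dil t (angL f).
Proof.
rewrite /angL !rmorphB/= !rmorphM/= rmorphB/= !rmorph_nat dil_rho2 lap_dil.
by rewrite !euler_dil; ring.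
Qed.

Lemma gdot_dil t f g : gdot (dil t f) (dil t g) = cstf t ^+ 2 * dil t (gdot f g).
Proof.
rewrite /gdot raddf_sum mulr_sumr; apply: eq_bigr => i _.
by rewrite !pd_dil/= rmorphM/=; ring.
Qed.

Lemma angG_dil t f g : angG (dil t f) (dil t g) = dil t (angG f g).
Proof.
by rewrite /angG rmorphB/= !rmorphM/= dil_rho2 gdot_dil !euler_dil; ring.
Qed.

End dilation.

(** * Integration on balls and spheres *)

Section topology_rV.
Context (R : realType) (n : nat).
Implicit Types (y : 'rV[R]_n) (r : R).

Lemma measurable_box (P : 'I_n -> set R) : (forall i, measurable (P i)) ->
  measurable [set y : 'rV[R]_n | forall i, P i (y ord0 i)].
Proof.
move=> mP; rewrite (_ : mkset _ =
    \bigcap_(i in [set: 'I_n]) ((fun y => y ord0 i : measurableTypeR R) @^-1` P i)).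
  apply: fin_bigcap_measurable => // i _.
  by have := @measurable_coord R n i measurableT _ (mP i); rewrite setTI.
by apply/seteqP; split=> y /= H i; [move=> _; exact: H|exact: H].
Qed.

Lemma measurable_rV_ball y r : measurable (ball y r).
Proof.
have [r0|r0] := leP r 0.
  rewrite (_ : ball y r = set0)//; apply/seteqP; split=> z //=.
  by move=> [r1 _]; move: r0; rewrite leNgt r1.
rewrite (_ : ball y r = [set z : 'rV[R]_n | forall i, ball (y ord0 i) r (z ord0 i)]).
  by apply: (@measurable_box (fun i => ball (y ord0 i) r)) => i; exact: measurable_ball.
apply/seteqP; split=> z /=; first by move=> [_ H] i; exact: H.
by move=> H; split=> // i j; rewrite (ord1 i).
Qed.

(** The sigma-algebra is generated by the coordinates, so [U] is written as the countable union of
    the balls of rational centre and radius [k.+1%:R^-1] that it contains. *)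
Lemma open_measurable_rV (U : set 'rV[R]_n) : open U -> measurable U.
Proof.
move=> oU.
pose B (qk : 'rV[rat]_n * nat) : set 'rV[R]_n :=
  ball (map_mx (ratr : rat -> R) qk.1) (qk.2.+1%:R^-1).
rewrite (_ : U = \bigcup_qk (if `[<B qk `<=` U>] then B qk else set0)).
  apply: countable_bigcupT_measurable => [|qk]; first exact: countableP.
  by case: ifPn => // _; exact: measurable_rV_ball.
apply/seteqP; split=> [y Uy|y [qk _]]; last by case: asboolP => [+ /= ByU|//]; apply.
have [r /= r0 H] := (nbhs_ballP y _).1 (open_nbhs_nbhs (conj oU Uy)).
have r20 : 0 < r / 2 by rewrite divr_gt0.
have [k kr] : exists k : nat, k.+1%:R^-1 < r / 2 :> R.
  have [k _ Hk] := near_infty_natSinv_lt (PosNum r20).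
  by exists k; exact: (Hk k (leqnn k)).
have k0 : 0 < k.+1%:R^-1 :> R by rewrite invr_gt0.
have /choice[q qP] : forall i : 'I_n, exists q : rat,
    ratr q \in `](y ord0 i - k.+1%:R^-1), (y ord0 i + k.+1%:R^-1)[.
  by move=> i; apply: rat_in_itvoo; rewrite ltrD2l (lt_trans _ k0)// oppr_lt0.
have By : B (\row_i q i, k) y.
  split=> // i j; rewrite !mxE /ball/= (ord1 i) ltr_distl.
  by have := qP j; rewrite in_itv/= => /andP[q1 q2]; rewrite ltrBlDr q2 -ltrBlDr q1.
exists (\row_i q i, k) => //; case: asboolP => // nBU; exfalso; apply: nBU.
move=> z Bz; apply: H; rewrite (splitr r).
apply: (@ball_triangle _ _ (map_mx (ratr : rat -> R) (\row_i q i))).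
  by apply/ball_sym; apply: le_ball By; exact: ltW.
by apply: le_ball Bz; exact: ltW.
Qed.

Lemma continuous_measurable_rV (f : 'rV[R]_n -> R) (D : set 'rV[R]_n) :
  continuous f -> measurable_fun D f.
Proof.
move=> /continuousP cf; apply: measurable_funTS.
apply: (measurability _ (RGenOpens.measurableE R)).
move=> _ [_ [a [b ->] <-]]; rewrite setTI; apply: open_measurable_rV.
exact/cf/interval_open.
Qed.

Lemma dotv_ge0 y : 0 <= dotv y y.
Proof. by apply: sumr_ge0 => i _; rewrite -expr2 sqr_ge0. Qed.

Lemma enorm_ge0 y : 0 <= enorm y. Proof. exact: sqrtr_ge0. Qed.

Lemma sqr_enorm y : enorm y ^+ 2 = dotv y y.
Proof. by rewrite sqr_sqrtr// dotv_ge0. Qed.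

Lemma enormZ a y : enorm (a *: y) = `|a| * enorm y.
Proof.
rewrite /enorm -sqrtr_sqr -sqrtrM ?sqr_ge0//; congr Num.sqrt.
by rewrite /dotv mulr_sumr; apply: eq_bigr => i _; rewrite !mxE; ring.
Qed.

Lemma enorm0 : enorm (0 : 'rV[R]_n) = 0.
Proof. by rewrite -(scale0r 0) enormZ normr0 mul0r. Qed.

Lemma coord_le_enorm y i : `|y ord0 i| <= enorm y.
Proof.
rewrite -sqrtr_sqr ler_sqrt ?dotv_ge0// /dotv (bigD1 i)//= -expr2 lerDl.
by apply: sumr_ge0 => j _; rewrite -expr2 sqr_ge0.
Qed.

Lemma enorm_eq0 y : enorm y = 0 -> y = 0.
Proof.
move=> y0; apply/rowP => i; rewrite mxE; apply/eqP.
by rewrite -normr_eq0 eq_le normr_ge0 andbT -y0 coord_le_enorm.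
Qed.

(** The Euclidean ball lies in a cube, which is compact as a product of segments. *)
Lemma enorm_bounded_continuous (f : 'rV[R]_n -> R) r : continuous f ->
  exists C, 0 <= C /\ forall y, enorm y <= r -> `|f y| <= C.
Proof.
move=> cf.
have cK := @rV_compact R n (fun=> `[(- r), r]%classic) (fun=> segment_compact (a:=-r) (b:=r)).
have [M [_ HM]] := compact_bounded (continuous_compact (continuous_subspaceT cf) cK).
exists (`|M| + 1); split; first by rewrite addr_ge0.
move=> y yr; apply: (HM (`|M| + 1)).
  by rewrite (le_lt_trans (ler_norm M))// ltrDl.
exists y => // i /=; rewrite in_itv/= -ler_norml.
exact: le_trans (coord_le_enorm y i) yr.
Qed.

End topology_rV.

(** * Smooth integrands on a set of finite measure in the closed unit ball, such as the ball or the
    sphere *)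

Section bounded_set_integral.
Context (R : realType) (n : nat) (mu : {measure set 'rV[R]_n -> \bar R})
  (E : set 'rV[R]_n).
Hypothesis mE : measurable E.
Hypothesis finE : (mu E < +oo)%E.
Hypothesis bE : forall y, E y -> enorm y <= 1.
Local Notation sfn := (sfn R n).
Implicit Types (f g : sfn).

Local Notation I f := (\int[mu]_(y in E) f y).

Lemma bounded_integrable (h : 'rV[R]_n -> R) (C : R) : measurable_fun E h ->
  (forall y, E y -> `|h y| <= C) -> mu.-integrable E (EFin \o h).
Proof.
move=> mh hC; apply: measurable_bounded_integrable => //.
exists C; split; first exact: num_real.
by move=> M CM y Ey; exact: le_trans (hC y Ey) (ltW CM).
Qed.

Lemma continuous_integrable (h : 'rV[R]_n -> R) : continuous h ->
  mu.-integrable E (EFin \o h).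
Proof.
move=> ch; have [C [_ hC]] := enorm_bounded_continuous 1 ch.
apply: (@bounded_integrable _ C); first exact: continuous_measurable_rV.
by move=> y /bE; exact: hC.
Qed.

Lemma sfn_continuous f : continuous f.
Proof. exact/smooth_continuous/smooth_sfn. Qed.

Lemma sfn_integrable f : mu.-integrable E (EFin \o f).
Proof. exact/continuous_integrable/sfn_continuous. Qed.

Lemma sfn_integralD f g : I (f + g) = I f + I g.
Proof. by rewrite -RintegralD//; exact: sfn_integrable. Qed.

Lemma sfn_integralZ c f : I (cstf c * f) = c * I f.
Proof. by rewrite -RintegralZl//; exact: sfn_integrable. Qed.

Lemma is_derive_dilation (f : sfn) (y : 'rV[R]_n) (t : R) : t != 0 ->
  is_derive t 1 (fun s => f (s *: y)) (t^-1 * euler f (t *: y)).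
Proof.
move=> t0; have := @is_derive_line _ _ f 0 y t (sfn_differentiable _ _).
rewrite (_ : (fun s => f (0 + s *: y)) = (fun s => f (s *: y))); last first.
  by apply/funext => s; rewrite add0r.
rewrite add0r derive_sum_pderiv; last exact: sfn_differentiable.
rewrite [X in is_derive _ _ _ X](_ : _ = t^-1 * euler f (t *: y))//.
rewrite sfn_sumE mulr_sumr; apply: eq_bigr => i _.
by rewrite sfnME /= mxE !mulrA mulVf// mul1r.
Qed.

(** Differentiation under the integral sign for [t] in [](l / 2), (l + l)[]: there [t^-1] is at most
    [(l / 2)^-1], and [t *: y] stays in the ball of radius [l + l], on which [euler f] is bounded by
    [C]. *)
Lemma is_derive_integral_dilation (f : sfn) (l : R) : 0 < l ->
  is_derive l 1 (fun t => \int[mu]_(y in E) f (t *: y))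
    (l^-1 * \int[mu]_(y in E) euler f (l *: y)).
Proof.
move=> l0; have l20 : 0 < l / 2 by rewrite divr_gt0.
have [C [C0 HC]] := enorm_bounded_continuous (l + l) (@sfn_continuous (euler f)).
pose F (t : R) (y : 'rV[R]_n) := f (t *: y).
have I1 t : t \in `](l / 2), (l + l)[ -> 0 < t.
  by rewrite in_itv/= => /andP[t1 _]; exact: lt_trans t1.
have dF t y : t \in `](l / 2), (l + l)[ -> partial1of2 F t y = t^-1 * euler f (t *: y).
  move=> /I1 t0; rewrite /partial1of2 derive1E.
  have := @is_derive_dilation f y t; rewrite gt_eqF// => /(_ isT) H.
  exact: derive_val.
have il : l \in `](l / 2), (l + l)[.
  by rewrite in_itv/=; apply/andP; split; lra.
have -> : l^-1 * \int[mu]_(y in E) euler f (l *: y)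
    = \int[mu]_(y in E) partial1of2 F l y.
  rewrite -RintegralZl//; last exact: (sfn_integrable (dil l (euler f))).
  by apply: eq_Rintegral => y _; rewrite dF.
have := @cvg_differentiation_under_integral _ _ _ mu F E mE l (l / 2) (l + l) il _ _
  (fun=> (l / 2)^-1 * C).
rewrite (_ : (fun h : R => h^-1 *: (\int[mu]_(y in E) F (h + l) y - \int[mu]_(y in E) F l y))
   = (fun h => h^-1 *: (\int[mu]_(y in E) F (h *: (1 : R) + l) y - \int[mu]_(y in E) F l y)));
  last by apply/funext => h; have -> : h *: (1 : R) = h by exact: mulr1.
set J := _ @ _ --> _ => H; have {}H : J.
  apply: H => //.
  + by move=> t _; exact: (sfn_integrable (dil t f)).
  + move=> t y ty _; have := @is_derive_dilation f y t.
    by rewrite gt_eqF ?(I1 t)// => /(_ isT) H; exact: ex_derive.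
  + by move=> y; rewrite mulr_ge0// invr_ge0 ltW.
  + apply: (@bounded_integrable _ ((l / 2)^-1 * C)); first exact: measurable_cst.
    by move=> y _; rewrite ger0_norm// mulr_ge0// invr_ge0 ltW.
  + move=> t y tl Ey; rewrite dF// normrM [`|t^-1|]gtr0_norm ?invr_gt0; last exact: I1.
    have t0 := I1 t tl; move: tl; rewrite /= in_itv/= => /andP[t1 t2].
    apply: ler_pM => //; first by rewrite invr_ge0 ltW.
      by rewrite lef_pV2 ?posrE// ltW.
    apply: HC; rewrite enormZ gtr0_norm//.
    apply: le_trans (ltW t2); apply: ler_piMr; [exact: ltW|exact: bE].
apply: DeriveDef; [apply/cvg_ex; eexists; exact: H|apply: cvg_lim => //; exact: H].
Qed.

End bounded_set_integral.

(** * Lebesgue measure under translations and dilations *)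

Section affine_measure.
Context (R : realType).
Local Notation leb := (@lebesgue_measure R).

Lemma measurable_affine_line (b a : R) :
  measurable_fun setT (fun t : measurableTypeR R => b + a * t : measurableTypeR R).
Proof. by apply: measurable_funD => //; exact: measurable_funM. Qed.

(** Uniqueness of Lebesgue measure: [a] times the pushforward gives half-open intervals their
    length. *)
Lemma lebesgue_measure_affine (b a : R) (A : set (measurableTypeR R)) :
  0 < a -> measurable A ->
  leb ((fun t => b + a * t) @^-1` A) = ((a^-1)%:E * leb A)%E.
Proof.
move=> a0 mA.
pose nu := mscale (NngNum (ltW a0))
  (measure_function_pushforward__canonical__measure_function_Measure leb
     (measurable_affine_line b a)).
have /(_ A mA) -> : forall B, measurable B -> leb B = nu B.
  apply: lebesgue_measure_unique => _ [[u v]] _ <-.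
  transitivity (a%:E * leb ((fun t => (b + a * t)%R) @^-1` `]u, v]%classic))%E; last by [].
  rewrite (_ : _ @^-1` _ = `]((u - b) / a), ((v - b) / a)]%classic).
    rewrite !lebesgue_measure_itv/= !lte_fin ltr_pM2r ?invr_gt0// ltrD2r.
    case: ifPn => uv; last by rewrite mule0.
    by rewrite -!EFinB -EFinM; congr EFin; field; rewrite gt_eqF.
  apply/seteqP; split=> t /=; rewrite !in_itv/= ltr_pdivrMr// ler_pdivlMr//;
    by rewrite ltrBlDr lerBrDr [t * a]mulrC [_ + b]addrC.
by rewrite /nu /mscale/= muleA -EFinM mulVf ?gt_eqF// mul1e.
Qed.

Lemma ge0_integral_affine_line (b a : R) (f : measurableTypeR R -> \bar R) :
  0 < a -> measurable_fun setT f -> (forall t, 0 <= f t)%E ->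
  (\int[leb]_t f (b + a * t)%R = (a^-1)%:E * \int[leb]_t f t)%E.
Proof.
move=> a0 mf f0.
have := ge0_integral_pushforward (measurable_affine_line b a) leb measurableT mf
  (fun y _ => f0 y).
rewrite preimage_setT => <-.
have ai : 0 <= a^-1 by rewrite invr_ge0 ltW.
rewrite -(@ge0_integral_mscale _ _ _ leb _ measurableT (NngNum ai))//.
apply: eq_measure_integral; first exact: measurable_affine_line.
move=> ? A mA _; exact: (lebesgue_measure_affine b a0 mA).
Qed.

Lemma measurable_affine n (x : 'rV[R]_n) (a : R) :
  measurable_fun [set: 'rV[R]_n] (fun y : 'rV[R]_n => x + a *: y).
Proof.
apply: measurable_fun_rVP => i; under eq_fun do rewrite !mxE.
apply: measurable_funD => //; apply: measurable_funM => //.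
exact: measurable_coord.
Qed.

Lemma measurable_affine_preimage n (x : 'rV[R]_n) (a : R) (A : set 'rV[R]_n) :
  measurable A -> measurable ((fun y : 'rV[R]_n => x + a *: y) @^-1` A).
Proof.
by move=> mA; rewrite -[X in measurable X]setTI; exact: measurable_affine.
Qed.

(** Induction on the dimension by slicing: a section of the preimage is the affine preimage of a
    section of [A], which gives [(a^-1) ^+ n]; the change of variable in the first coordinate gives
    the last factor. *)
Lemma lebesgue_rV_affine n (x : 'rV[R]_n) (a : R) (A : set 'rV[R]_n) :
  0 < a -> measurable A ->
  lebesgue_rV R n ((fun y => x + a *: y) @^-1` A) =
  (((a^-1) ^+ n)%:E * lebesgue_rV R n A)%E.
Proof.
move=> a0; elim: n x A => [|n IH] x A mA.
  rewrite expr0 mul1e; congr (lebesgue_rV R 0 _).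
  by apply/seteqP; split=> y /=; rewrite [_ + _]thinmx0 [y]thinmx0.
rewrite [LHS]/= /lebesgue_step /pushforward.
pose P := (@rV_cons R n) @^-1` A.
have mP : measurable P.
  by have := @measurable_rV_cons R n measurableT _ mA; rewrite setTI.
pose x' : 'rV[R]_n := \row_i x ord0 (lift ord0 i).
pose phi t := lebesgue_rV R n (xsection P t).
transitivity (\int[leb]_t (((a^-1) ^+ n)%:E * phi (x ord0 ord0 + (a : measurableTypeR R) * t)%R))%E.
  rewrite /product_measure1; apply: eq_integral => t _ /=.
  rewrite /phi -(IH x'); last exact: measurable_xsection.
  congr (lebesgue_rV R n _).
  apply/seteqP; split=> v /=; rewrite /xsection /= !in_setE /P /=;
   congr A; apply/rowP => i; rewrite !mxE; case: unliftP => [j ->|->];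
   by rewrite ?mxE ?liftK ?unlift_none.
have mphi : measurable_fun setT phi by exact: measurable_fun_xsection.
have a1 : (0 <= ((a^-1) ^+ n)%:E)%E by rewrite lee_fin exprn_ge0// invr_ge0 ltW.
rewrite ge0_integralZl//; last first.
  exact: (measurableT_comp mphi (measurable_affine_line _ _)).
rewrite ge0_integral_affine_line// muleA -EFinM -exprSr.
by [].
Qed.

End affine_measure.

(** * Change of variables for a multiple of a pushforward measure *)

Section scaled_pushforward.
Context d1 d2 (X : measurableType d1) (Y : measurableType d2) (R : realType).
Variables (mu : {measure set X -> \bar R}) (nu : {measure set Y -> \bar R}).
Variables (phi : X -> Y) (c : R) (D : set Y).
Hypotheses (c0 : 0 <= c) (mphi : measurable_fun setT phi) (mD : measurable D).
Hypothesis nuE : forall A, measurable A -> A `<=` D ->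
  nu A = (c%:E * mu (phi @^-1` A))%E.

Lemma ge0_integral_scaled_pushforward (f : Y -> \bar R) :
  measurable_fun setT f -> (forall t, 0 <= f t)%E ->
  (\int[nu]_(y in D) f y = c%:E * \int[mu]_(x in phi @^-1` D) f (phi x))%E.
Proof.
move=> mf f0.
have := ge0_integral_pushforward mphi mu mD (measurable_funTS mf) (fun y _ => f0 y).
move=> <-; rewrite -(@ge0_integral_mscale _ _ _ _ _ mD (NngNum c0))//; last first.
  exact: measurable_funTS.
apply: eq_measure_integral => A mA AD; exact: nuE.
Qed.

(** Serves twice: with an affine [phi] and [c = a ^+ n] for Lebesgue measure, and with the
    projection onto the sphere and [c = n%:R] for the surface measure. *)
Lemma Rintegral_scaled_pushforward (f : Y -> R) :
  measurable_fun setT f -> nu.-integrable D (EFin \o f) ->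
  \int[nu]_(y in D) f y = c * \int[mu]_(x in phi @^-1` D) f (phi x).
Proof.
(* The case [c = 0] occurs for the sphere in dimension 0. It is separate because finiteness of
   [c * a] then says nothing about [a]. *)
move=> mf If; have [c00|c1] := eqVneq c 0.
  rewrite c00 mul0r /Rintegral integralE.
  have mef : measurable_fun setT (EFin \o f) by exact/measurable_EFinP.
  rewrite (ge0_integral_scaled_pushforward (measurable_funepos mef))//.
  rewrite (ge0_integral_scaled_pushforward (measurable_funeneg mef))//.
  by rewrite c00 !mul0e sube0.
rewrite /Rintegral [in LHS]integralE [in RHS]integralE.
have mef : measurable_fun setT (EFin \o f) by exact/measurable_EFinP.
have H1 := ge0_integral_scaled_pushforward (measurable_funepos mef)
  (fun t => funepos_ge0 (EFin \o f) t).
have H2 := ge0_integral_scaled_pushforward (measurable_funeneg mef)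
  (fun t => funeneg_ge0 (EFin \o f) t).
have E1 : (fun x => ((fun x0 => (f (phi x0))%:E)^\+ x)%E)
  = (fun x => ((EFin \o f)^\+ (phi x))%E).
  by apply/funext => y; rewrite !funepos.unlock.
have E2 : (fun x => ((fun x0 => (f (phi x0))%:E)^\- x)%E)
  = (fun x => ((EFin \o f)^\- (phi x))%E).
  by apply/funext => y; rewrite !funeneg.unlock.
have I1 := integrable_pos_fin_num mD If; have I2 := integrable_neg_fin_num mD If.
have fin a : (c%:E * a \is a fin_num -> a \is a fin_num)%E.
  have cp : (0 < c%:E)%E by rewrite lte_fin lt_neqAle eq_sym c1.
  by case: a => [r //||]; rewrite ?gt0_muley ?gt0_muleNy.
rewrite H1 in I1; rewrite H2 in I2; rewrite E1 E2 H1 H2.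
rewrite -muleBr//; last by rewrite fin_num_adde_defr//; exact: fin.
by rewrite fineM// fin_numB (fin _ I1) (fin _ I2).
Qed.

End scaled_pushforward.

Section affine_integral.
Context (R : realType) (n : nat).
Local Notation leb := (lebesgue_rV R n).
Implicit Types (x : 'rV[R]_n) (a : R) (D : set 'rV[R]_n).

Lemma Rintegral_affine x a D (f : 'rV[R]_n -> R) :
  0 < a -> measurable D -> measurable_fun setT f -> leb.-integrable D (EFin \o f) ->
  \int[leb]_(y in D) f y =
  a ^+ n * \int[leb]_(y in (fun y => x + a *: y) @^-1` D) f (x + a *: y).
Proof.
move=> a0 mD mf If; have an : 0 <= a ^+ n by rewrite exprn_ge0// ltW.
have := @Rintegral_scaled_pushforward _ _ _ _ R leb leb (fun y => x + a *: y)
  (a ^+ n) D an (measurable_affine x a) mD _ f mf If.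
apply=> A mA _; have := lebesgue_rV_affine x a0 mA.
rewrite /preimage /= => ->; rewrite muleA -EFinM exprVn mulfV ?mul1e//.
by rewrite expf_neq0// gt_eqF.
Qed.

Lemma eball_affine x (r s : R) : 0 < r ->
  (fun y => x + r *: y) @^-1` eball x (r * s) = eball 0 s.
Proof.
move=> r0; apply/seteqP; split=> y /=; rewrite /eball/= addrAC subrr add0r subr0;
  by rewrite enormZ gtr0_norm// ltr_pM2l.
Qed.

Lemma measurable_eball x r : measurable (eball x r).
Proof.
rewrite (_ : eball x r = (fun y => - x + 1 *: y) @^-1` eball 0 r).
  by apply: measurable_affine_preimage; exact: measurable_eball0.
by apply/seteqP; split=> y /=; rewrite /eball/= scale1r subr0 addrC.
Qed.

Lemma eball_le r y : eball (0 : 'rV[R]_n) r y -> enorm y <= r.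
Proof. by rewrite /eball/= subr0 => /ltW. Qed.

End affine_integral.

Lemma measurable_cube (R : realType) (n : nat) (r : R) :
  measurable [set y : 'rV[R]_n | forall i, y ord0 i \in `[- r, r]].
Proof.
by apply: (@measurable_box _ _ (fun=> `[- r, r]%classic)) => i; exact: measurable_itv.
Qed.

Lemma lebesgue_rV_cube_lty (R : realType) (n : nat) (r : R) :
  (lebesgue_rV R n [set y : 'rV[R]_n | forall i, y ord0 i \in `[(- r)%R, r]] < +oo)%E.
Proof.
elim: n => [|n IH]; first by rewrite /= diracE; case: (_ \in _); rewrite ltry.
rewrite /= /lebesgue_step /pushforward.
rewrite (_ : _ @^-1` _ = `[(- r), r]%classic `*`
  [set y : 'rV[R]_n | forall i, (y ord0 i) \in `[(- r), r]]); last first.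
  apply/seteqP; split=> [[t v] H|[t v] [/= t1 vi] i].
    split=> [|i]; first by have := H ord0; rewrite /rV_cons mxE unlift_none.
    by have := H (lift ord0 i); rewrite /rV_cons mxE liftK.
  by rewrite /rV_cons mxE; case: unliftP => [j _|_] //=; exact: vi.
have mi : measurable (`[(- r), r]%classic : set (measurableTypeR R)) by [].
rewrite (product_measure1E _ _ mi (@measurable_cube R n r)).
rewrite [X in (X * _)%E](_ : _ = (Num.max 0 (2 * r))%:E); last first.
  rewrite -[LHS]/(lebesgue_measure (`[(- r), r]%classic : set (measurableTypeR R))).
  rewrite lebesgue_measure_itv/= lte_fin; case: ifPn => rr.
    by rewrite -EFinB; congr EFin; rewrite max_r; lra.
  by rewrite max_l//; move: rr; rewrite -leNgt; lra.
by rewrite lte_mul_pinfty// lee_fin le_max lexx.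
Qed.

Lemma lebesgue_eball_lty (R : realType) (n : nat) (r : R) :
  (lebesgue_rV R n (eball 0 r) < +oo)%E.
Proof.
apply: le_lt_trans (lebesgue_rV_cube_lty n r).
apply: le_measure; rewrite ?inE; first exact: measurable_eball.
  exact: measurable_cube.
move=> y /eball_le yr i; rewrite in_itv/= -ler_norml.
exact: le_trans (coord_le_enorm y i) yr.
Qed.

(** * The surface integral as an integral over the ball *)

Section sphere_integral.
Context (R : realType) (n : nat).
Local Notation leb := (lebesgue_rV R n).
Local Notation sig := (sphere_measure R n).
Local Notation B := (eball (0 : 'rV[R]_n) 1).
Local Notation S := (usphere R n).
Implicit Types (f : 'rV[R]_n -> R) (y : 'rV[R]_n).

Lemma measurable_usphere : measurable S.
Proof.
rewrite (_ : S = (@enorm R n : _ -> measurableTypeR R) @^-1` [set 1]).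
  by rewrite -[X in measurable X]setTI; apply: measurable_enorm => //; exact: measurable_set1.
by apply/seteqP; split.
Qed.

Lemma sphere_measure_lty : (sig S < +oo)%E.
Proof.
rewrite /sphere_measure; apply: lte_mul_pinfty => //.
apply: le_lt_trans (lebesgue_eball_lty n 1); apply: le_measure; rewrite ?inE.
- apply: measurableI; last exact: measurable_eball0.
  rewrite -[X in measurable X]setTI.
  by apply: measurable_normalize => //; exact: measurable_usphere.
- exact: measurable_eball0.
- exact: subIsetr.
Qed.

Lemma eball_enorm y : B y <-> enorm y < 1.
Proof. by rewrite /eball/= subr0. Qed.

Lemma usphere_le y : S y -> enorm y <= 1. Proof. by move=> ->. Qed.

Lemma enorm_gt0 y : y != 0 -> 0 < enorm y.
Proof.
move=> y0; rewrite lt_neqAle enorm_ge0 andbT eq_sym.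
by apply: contra y0 => /eqP/enorm_eq0 ->.
Qed.

Lemma enorm_normalize y : y != 0 -> enorm (normalize y) = 1.
Proof.
move=> /enorm_gt0 y0; rewrite /normalize enormZ ger0_norm ?invr_ge0 ?enorm_ge0//.
by rewrite mulVf// gt_eqF.
Qed.

(** The extension of [f] from the sphere that is constant along rays. The origin lies on no ray and
    gets the value 0, so that it does not count in the cone over the sphere. *)
Definition radial_ext f : 'rV[R]_n -> R :=
  (fun y => f (normalize y)) \_ (~` [set 0]).

Lemma radial_extE f y : y != 0 -> radial_ext f y = f (normalize y).
Proof. by move=> y0; rewrite /radial_ext patchE ifT// inE/=; exact/eqP. Qed.

Lemma radial_extZ f (s : R) y : 0 < s -> radial_ext f (s *: y) = radial_ext f y.
Proof.
move=> s0; have [->|y0] := eqVneq y 0; first by rewrite scaler0.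
rewrite !radial_extE ?scaler_eq0 ?negb_or ?gt_eqF//; congr f.
rewrite /normalize enormZ gtr0_norm// scalerA invfM mulrAC mulVf ?mul1r//.
by rewrite gt_eqF.
Qed.

Lemma measurable_set1_rV (x : 'rV[R]_n) : measurable [set x].
Proof.
rewrite (_ : [set x] = [set y | forall i, [set x ord0 i] (y ord0 i)]).
  apply: (@measurable_box _ _ (fun i => [set x ord0 i])) => i.
  exact: measurable_set1.
by apply/seteqP; split=> [y -> //|y /= H]; apply/rowP => i; exact: H.
Qed.

Lemma measurable_radial_ext f : continuous f -> measurable_fun setT (radial_ext f).
Proof.
move=> cf; apply/(measurable_restrict _ _ measurableT); rewrite ?setIT ?setTI.
  by apply: measurableC; exact: measurable_set1_rV.
apply: measurable_funTS.
apply: (measurableT_comp _ (@measurable_normalize R n)).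
exact: continuous_measurable_rV.
Qed.

Lemma radial_ext_bounded f : continuous f ->
  exists C, 0 <= C /\ forall y, `|radial_ext f y| <= C.
Proof.
move=> /(@enorm_bounded_continuous _ _ f 1)[C [C0 HC]]; exists C; split=> // y.
have [->|y0] := eqVneq y 0.
  by rewrite /radial_ext patchE ifF ?normr0// memNset// => /=; apply.
by rewrite radial_extE// HC// enorm_normalize.
Qed.

Lemma radial_ext_integrable f : continuous f -> leb.-integrable B (EFin \o radial_ext f).
Proof.
move=> cf; have [C [_ HC]] := radial_ext_bounded cf.
apply: (@bounded_integrable _ _ _ _ _ _ _ C) => //.
- exact: measurable_eball0.
- exact: lebesgue_eball_lty.
- by apply: measurable_funTS; exact: measurable_radial_ext.
Qed.

Lemma sphere_Rintegral f : continuous f ->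
  \int[sig]_(y in S) f y = n%:R * \int[leb]_(y in B) radial_ext f y.
Proof.
(* Points outside the ball are sent to 0, which is not on the sphere: on subsets of the sphere the
   surface measure is then [n%:R] times the pushforward of the whole Lebesgue measure. *)
move=> cf; pose phi y : 'rV[R]_n := \1_B y *: normalize y.
have phi1 y : B y -> phi y = normalize y.
  by move=> By; rewrite /phi indicE mem_set// scale1r.
have phi0 y : ~ B y -> phi y = 0.
  by move=> By; rewrite /phi indicE memNset// scale0r.
have mphi : measurable_fun setT phi.
  apply: measurable_fun_rVP => i; under eq_fun do rewrite mxE.
  apply: measurable_funM.
    by apply: measurable_indic; exact: measurable_eball0.
  exact: (measurableT_comp (@measurable_coord R n i) (@measurable_normalize R n)).
have S0 : ~ S 0 by rewrite /usphere/= enorm0 => /eqP; rewrite eq_sym oner_eq0.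
have nuE A : measurable A -> A `<=` S -> sig A = (n%:R%:E * leb (phi @^-1` A))%E.
  move=> mA AS; rewrite /sphere_measure; congr (_ * leb _)%E.
  apply/seteqP; split=> y /=; first by case=> Ay By; rewrite phi1.
  move=> Ay; have [By|nBy] := pselect (B y); first by rewrite phi1 in Ay.
  by move: Ay; rewrite phi0// => /AS.
have fI : sig.-integrable S (EFin \o f).
  apply: continuous_integrable => //.
  - exact: measurable_usphere.
  - exact: sphere_measure_lty.
  - exact: usphere_le.
rewrite (Rintegral_scaled_pushforward _ mphi measurable_usphere nuE _ fI)//; last first.
  exact: continuous_measurable_rV.
congr (_ * _); rewrite /radial_ext -Rintegral_mkcondr.
have -> : phi @^-1` S = B `&` ~` [set 0].
  apply/seteqP; split=> y /=.
    have [By|nBy] := pselect (B y); last by rewrite phi0// => /S0.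
    by rewrite phi1// => Sy; split=> // y0; move: Sy; rewrite y0 /normalize scaler0.
  by move=> [By /eqP y0]; rewrite phi1// /usphere /= enorm_normalize.
by apply: eq_Rintegral => y; rewrite inE => -[By _]; rewrite phi1.
Qed.

End sphere_integral.

(** * From sphere integrals to ball integrals *)

Section ball_sphere.
Context (R : realType) (n : nat).
Local Notation leb := (lebesgue_rV R n).
Local Notation sig := (sphere_measure R n).
Local Notation B := (eball (0 : 'rV[R]_n) 1).
Local Notation S := (usphere R n).
Local Notation sfn := (sfn R n).
Local Notation N := (n%:R : sfn).
Local Notation IB f := (\int[leb]_(y in B) f y).
Local Notation IS f := (\int[sig]_(y in S) f y).
Implicit Types (f g : sfn) (y : 'rV[R]_n).

Lemma ball_sfn_integrable f : leb.-integrable B (EFin \o f).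
Proof.
apply: sfn_integrable; [exact: measurable_eball0|exact: lebesgue_eball_lty|].
exact: eball_le.
Qed.

(** Mean value theorem along the ray from [y] to the sphere. The derivative there is
    [t^-1 * euler f (t *: w)] with [t >= 2^-1], hence the factor 2. *)
Lemma radial_ext_sub_bound f (s : R) y : 2^-1 <= s < 1 -> s <= enorm y < 1 ->
  forall C, (forall z, enorm z <= 1 -> `|euler f z| <= C) ->
  `|f y - radial_ext f y| <= 2 * C * (1 - s).
Proof.
move=> /andP[s1 s2] /andP[ys y1] C HC.
have r0 : 0 < enorm y by lra.
have y0 : y != 0 by apply: contraTneq r0 => ->; rewrite enorm0 ltxx.
rewrite radial_extE//; pose w := normalize y.
have w1 : enorm w = 1 by exact: enorm_normalize.
have yE : y = enorm y *: w by rewrite /w /normalize scalerA mulfV ?scale1r// gt_eqF.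
pose g (t : R) := f (t *: w).
pose dg (t : R) := t^-1 * euler f (t *: w).
have gd (t : R) : t \in `]enorm y, 1[ -> is_derive t 1 g (dg t).
  rewrite in_itv/= => /andP[t1 _]; apply: is_derive_dilation.
  by rewrite gt_eqF// (lt_trans r0).
have gc : {within `[enorm y, 1], continuous g}.
  apply: derivable_within_continuous => t; rewrite in_itv/= => /andP[t1 _].
  have tn : t != 0 by rewrite gt_eqF// (lt_le_trans r0).
  exact: (@ex_derive _ _ _ _ _ _ _ (is_derive_dilation f w tn)).
have [c] := MVT_segment (ltW y1) gd gc; rewrite in_itv/= => /andP[c1 c2].
rewrite {1}/g scale1r -/w => E.
have -> : f y - f w = - (dg c * (1 - enorm y)) by rewrite -E /g -yE opprB.
have c0 : 0 < c by lra.
have : `|dg c| <= 2 * C.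
  rewrite /dg normrM gtr0_norm ?invr_gt0//; apply: ler_pM => //.
  - by rewrite invr_ge0 ltW.
  - by rewrite invf_ple ?posrE//; lra.
  - by apply: HC; rewrite enormZ w1 mulr1 gtr0_norm.
move=> H; rewrite normrN; move: (dg c) H => d H.
rewrite normrM; apply: ler_pM => //.
by rewrite ger0_norm; lra.
Qed.

Lemma ball_dilation (s : R) (f : 'rV[R]_n -> R) : 0 < s -> s <= 1 ->
  measurable_fun setT f -> leb.-integrable B (EFin \o f) ->
  \int[leb]_(y in eball 0 s) f y = s ^+ n * IB (fun y => f (s *: y)).
Proof.
move=> s0 s1 mf If; have ms : measurable (eball (0 : 'rV[R]_n) s) by exact: measurable_eball.
have sB : eball (0 : 'rV[R]_n) s `<=` B.
  by move=> y; rewrite /eball/= => /lt_le_trans; apply.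
rewrite (@Rintegral_affine _ _ 0 s)//; last first.
  by apply: integrableS If => //; exact: measurable_eball0.
have := eball_affine (0 : 'rV[R]_n) 1 s0; rewrite mulr1 => ->.
by congr (_ * _); apply: eq_Rintegral => y _; rewrite add0r.
Qed.

Lemma lebesgue_ball_dilation (s : R) : 0 < s -> s <= 1 ->
  fine (leb (eball 0 s)) = s ^+ n * fine (leb B).
Proof.
move=> s0 s1; have := @ball_dilation s (cst 1) s0 s1 (measurable_cst _).
rewrite !Rintegral_cst ?mul1r; try exact: measurable_eball.
by apply; exact: (ball_sfn_integrable 1).
Qed.

Lemma normr_ball_integral_le (A : set 'rV[R]_n) (h : 'rV[R]_n -> R) (M : R) :
  measurable A -> (leb A < +oo)%E -> measurable_fun setT h ->
  (forall y, A y -> `|h y| <= M) -> `|\int[leb]_(y in A) h y| <= M * fine (leb A).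
Proof.
move=> mA fA mh hM.
have Ih : leb.-integrable A (EFin \o h).
  by apply: (bounded_integrable mA fA _ hM); exact: measurable_funTS.
apply: le_trans (le_normr_Rintegral mA Ih) _.
rewrite -Rintegral_cst//; apply: le_Rintegral => //.
- exact: integrable_norm.
- by apply: (@bounded_integrable _ _ _ _ mA fA _ `|M|) => //; exact: measurable_cst.
Qed.

Lemma is_derive_exprn1 : is_derive (1 : R) 1 (fun s : R => s ^+ n) (n%:R : R).
Proof.
apply: DeriveDef; first exact: exprn_derivable.
by rewrite -derive1E exp_derive1 expr1n [LHS]mulr1.
Qed.

Lemma sphere_ball_integral f : IS f = IB (N * f + euler f).
Proof.
have [C [C0 HC]] := enorm_bounded_continuous 1 (@sfn_continuous _ _ (euler f)).
have mf : measurable_fun setT f by apply: continuous_measurable_rV; exact: sfn_continuous.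
have mr := measurable_radial_ext (@sfn_continuous _ _ f).
have Ir := radial_ext_integrable (@sfn_continuous _ _ f).
have mB : measurable B by exact: measurable_eball.
pose q y := f y - radial_ext f y.
have mq : measurable_fun setT q by exact: measurable_funB.
pose P := IB (radial_ext f).
(* [G s] is the integral of [q] over the ball of radius [s], by scaling; the radial extension is
   unchanged by dilations and contributes only the constant [P]. *)
pose G (s : R) := s ^+ n * (IB (fun y => f (s *: y)) - P).
have Iq : leb.-integrable B (EFin \o q).
  exact: (integrableB mB (ball_sfn_integrable f) Ir).
have KE s : 0 < s -> s <= 1 -> \int[leb]_(y in eball 0 s) q y = G s.
  move=> s0 s1; rewrite ball_dilation//.
  rewrite /G /P -RintegralB//; last exact: (ball_sfn_integrable (dil s f)).
  by congr (_ * _); apply: eq_Rintegral => y _; rewrite /q radial_extZ.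
(* The increment of [G] is an integral over the shell between the radii [s] and 1, where the
   integrand and the measure are both O(1 - s). *)
have bnd s : 2^-1 <= s < 1 ->
    `|G s - G 1| <= 2 * C * (1 - s) * (fine (leb B) * (1 - s ^+ n)).
  move=> /andP[s1 s2]; have s0 : 0 < s by lra.
  have ms : measurable (eball (0 : 'rV[R]_n) s) by exact: measurable_eball.
  have sB : eball (0 : 'rV[R]_n) s `<=` B.
    by move=> y; rewrite /eball/= => /lt_trans; apply.
  have mD : measurable (B `\` eball 0 s) by exact: measurableD.
  have fD : (leb (B `\` eball 0 s) < +oo)%E.
    apply: le_lt_trans (lebesgue_eball_lty n 1).
    by apply: le_measure; rewrite ?inE//; exact: subDsetl.
  rewrite -!KE//; last by lra.
  have {1}-> : B = eball 0 s `|` (B `\` eball 0 s) by rewrite setDUK.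
  rewrite Rintegral_setU//; last 2 first.
  - by rewrite setDUK.
  - by apply/disj_setPS => y [? []].
  rewrite opprD addNKr normrN.
  apply: le_trans (normr_ball_integral_le mD fD mq _) _.
    move=> y [By nsy]; apply: (radial_ext_sub_bound (s := s) _ _ HC); first by rewrite s1.
    by move/eball_enorm: By => ->; rewrite andbT leNgt; apply/negP => ys; apply: nsy;
      rewrite /eball/= subr0.
  rewrite le_eqVlt; apply/orP; left; apply/eqP; congr (_ * _).
  rewrite measureD//; last exact: lebesgue_eball_lty.
  rewrite setIidr// fineB; last 2 first.
  - by rewrite ge0_fin_numE//; exact: lebesgue_eball_lty.
  - by rewrite ge0_fin_numE//; exact: lebesgue_eball_lty.
  by rewrite (lebesgue_ball_dilation s0 (ltW s2)); ring.
have dG : is_derive (1 : R) 1 G (n%:R * IB f + IB (euler f) - n%:R * P).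
  have H := @is_derive_integral_dilation _ _ leb B mB (lebesgue_eball_lty n 1)
     (@eball_le _ _ _) f 1 ltr01.
  have H1 : is_derive (1 : R) 1 (fun s => IB (fun y => f (s *: y)) - P)
     (1^-1 * IB (fun y => euler f (1 *: y)) - 0).
    by apply: is_deriveB.
  have := is_deriveM is_derive_exprn1 H1.
  move=> H2; apply: (is_derive_eq H2).
  have -> : IB (fun y => f (1 *: y)) = IB f.
    by apply: eq_Rintegral => y _; rewrite scale1r.
  have -> : IB (fun y => euler f (1 *: y)) = IB (euler f).
    by apply: eq_Rintegral => y _; rewrite scale1r.
  by rewrite expr1n invr1 /GRing.scale/=; ring.
have -> : IB (N * f + euler f) = n%:R * IB f + IB (euler f).
  rewrite -(rmorph_nat (@cstf R n)) -sfn_integralZ ?sfn_integralD//;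
    try exact: lebesgue_eball_lty; exact: eball_le.
rewrite sphere_Rintegral; last exact: sfn_continuous.
apply/eqP; rewrite -subr_eq0 -oppr_eq0 opprB; apply/eqP.
(* [G] is known to be differentiable at 1, so one sequence determines its derivative. It approaches
   from the left, where [bnd] applies, and the shift to [k.+2] gives [u k + 1 >= 2^-1]. *)
pose u (k : nat) : R := - k.+2%:R^-1.
have u0 : u k @[k --> \oo] --> 0.
  rewrite -oppr0; apply: cvgN; have := @cvg_harmonic R.
  by rewrite -(cvg_shiftS _) => H; apply: cvg_trans H.
have dGE : h^-1 *: (G (h + 1) - G 1) @[h --> 0^'] --> n%:R * IB f + IB (euler f) - n%:R * P.
  have := @ex_derive _ _ _ _ _ _ _ dG; have := @derive_val _ _ _ _ _ _ _ dG.
  rewrite /derivable /derive => <- /=.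
  under eq_fun do rewrite [_%:A]mulr1.
  by move=> H; exact: H.
have un k : u k != 0 by rewrite oppr_eq0 invr_eq0 pnatr_eq0.
move/cvgr_dnbhsP : dGE => /(_ u (conj un u0)) H1.
have H0 : (u k)^-1 *: (G (u k + 1) - G 1) @[k --> \oo] --> 0.
  apply: norm_cvg0.
  apply: (@squeeze_cvgr _ _ _ _ (cst 0) (fun k => 2 * C * (fine (leb B) * (1 - (u k + 1) ^+ n)))).
  - near=> k; rewrite normr_ge0/= normrM.
    have k2 : 0 < k.+2%:R^-1 :> R by rewrite invr_gt0.
    have k3 : k.+2%:R^-1 <= 2^-1 :> R by rewrite lef_pV2 ?posrE// ler_nat.
    have /bnd : 2^-1 <= u k + 1 < 1.
      by rewrite /u; move: (k.+2%:R^-1) k2 k3 => e k2 k3; apply/andP; split; lra.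
    have -> : 1 - (u k + 1) = - u k by ring.
    have uE : `|u k| = - u k by rewrite ler0_norm// oppr_le0 ltW.
    rewrite normfV ler_pdivrMl ?normr_gt0// uE => /le_trans; apply.
    by rewrite le_eqVlt; apply/orP; left; apply/eqP; ring.
  - exact: cvg_cst.
  - have -> : 0 = 2 * C * (fine (leb B) * (1 - (0 + 1) ^+ n)) :> R.
      by rewrite add0r expr1n subrr !mulr0.
    apply: cvgM; first exact: cvg_cst.
    apply: cvgM; first exact: cvg_cst.
    apply: cvgB; first exact: cvg_cst.
    have u1 : u k + 1 @[k --> \oo] --> (0 + 1 : R) by apply: cvgD => //; exact: cvg_cst.
    exact: (@cvg_comp _ _ _ _ (fun x : R => x ^+ n) _ _ _ u1 (@exprn_continuous R n _)).
rewrite -[LHS](cvg_lim _ H1)//; exact: (cvg_lim _ H0).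
Unshelve. all: by end_near. Qed.

End ball_sphere.

(** * The divergence theorem on the ball and Green's formula on the sphere *)

Section divergence.
Context (R : realType) (n : nat).
Local Notation leb := (lebesgue_rV R n).
Local Notation sig := (sphere_measure R n).
Local Notation B := (eball (0 : 'rV[R]_n) 1).
Local Notation S := (usphere R n).
Local Notation sfn := (sfn R n).
Local Notation N := (n%:R : sfn).
Local Notation X := (@xcoord R n).
Local Notation IB f := (\int[leb]_(y in B) f y).
Local Notation IS f := (\int[sig]_(y in S) f y).
Implicit Types (f g : sfn) (y : 'rV[R]_n).

(** The first-order expansion has an error of at most [h ^+ 2]. The positive part itself has a
    corner at 0, whence the square in the cut-off. *)
Lemma is_derive_sqr_max (a : R) :
  is_derive a 1 (fun s : R => Num.max 0 s ^+ 2) (2 * Num.max 0 a).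
Proof.
have bnd h : `|Num.max 0 (h + a) ^+ 2 - Num.max 0 a ^+ 2 - 2 * Num.max 0 a * h| <= h ^+ 2.
  have [a0|a0] := leP 0 a; have [h0|h0] := leP 0 (h + a); rewrite ler_norml;
    apply/andP; split; nra.
have H : h^-1 *: (Num.max 0 (h *: (1 : R) + a) ^+ 2 - Num.max 0 a ^+ 2) @[h --> 0^']
    --> 2 * Num.max 0 a.
  apply/cvgrPdist_le => e e0; near=> h.
  have h0 : h != 0 by near: h; exact: nbhs_dnbhs_neq.
  have -> : h *: (1 : R) = h by exact: mulr1.
  rewrite -(ler_pM2l (_ : 0 < `|h|)) ?normr_gt0// -normrM.
  have -> : h * (2 * Num.max 0 a - h^-1 *: (Num.max 0 (h + a) ^+ 2 - Num.max 0 a ^+ 2))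
     = - (Num.max 0 (h + a) ^+ 2 - Num.max 0 a ^+ 2 - 2 * Num.max 0 a * h).
    by rewrite /GRing.scale/= mulrBr mulVKf//; ring.
  rewrite normrN (le_trans (bnd h))// -real_normK ?num_real// expr2 ler_wpM2l//.
  by near: h; exact: dnbhs0_le.
by apply: DeriveDef; [apply/cvg_ex; eexists; exact: H|apply: cvg_lim => //; exact: H].
Unshelve. all: by end_near. Qed.

Lemma rho2E y : rho2 R n y = enorm y ^+ 2.
Proof.
rewrite sqr_enorm /rho2 sfn_sumE; apply: eq_bigr => i _.
by rewrite sfnXE expr2.
Qed.

Let M : sfn := 1 - rho2 R n.

Let M_gt0 y : 0 < M y <-> B y.
Proof.
rewrite eball_enorm /M sfnBE rho2E sfn1E subr_gt0.
by rewrite expr_lt1// enorm_ge0.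
Qed.

Section line.
Variables (i : 'I_n) (g : sfn).
Let e : 'rV[R]_n := delta_mx ord0 i.
(** The extension by zero of [M ^+ 2 * g] from the ball, written with a positive part so that it can
    be differentiated across the sphere; [hd] is its derivative along [e]. *)
Let h y : R := Num.max 0 (M y) ^+ 2 * g y.
Let hd y : R := 2 * Num.max 0 (M y) * pd i M y * g y + Num.max 0 (M y) ^+ 2 * pd i g y.

Let hE : h = (M ^+ 2 * g) \_ B.
Proof.
apply/funext => y; rewrite patchE /h; case: ifPn => [|].
  by rewrite inE => /M_gt0 My; rewrite max_r ?ltW// sfnME sfnXE.
rewrite notin_setE => nB; rewrite max_l ?expr0n ?mul0r// leNgt.
by apply/negP => /M_gt0.
Qed.

Let hdE : hd = (pd i (M ^+ 2 * g)) \_ B.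
Proof.
apply/funext => y; rewrite patchE /hd; case: ifPn => [|].
  rewrite inE => /M_gt0 My; rewrite max_r ?ltW// expr2 !pdM.
  by rewrite !(sfnDE, sfnME); ring.
rewrite notin_setE => nB; rewrite max_l ?expr0n ?mulr0 ?mul0r ?addr0// leNgt.
by apply/negP => /M_gt0.
Qed.

Let dh y (t : R) : is_derive t 1 (fun s => h (y + s *: e)) (hd (y + t *: e)).
Proof.
have HM := @is_derive_pderiv_line _ _ M i y t (smooth_sfn M).
have Hg := @is_derive_pderiv_line _ _ g i y t (smooth_sfn g).
have Hm : is_derive t 1 (fun s => Num.max 0 (M (y + s *: e)) ^+ 2)
    (2 * Num.max 0 (M (y + t *: e)) * pd i M (y + t *: e)).
  have := @is_derive1_comp R (fun s => Num.max 0 s ^+ 2) (fun s => M (y + s *: e)) t _ _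
    (is_derive_sqr_max _) HM.
  by move=> H; apply: (is_derive_eq H); rewrite mulrC.
have := is_deriveM Hm Hg => H; apply: (is_derive_eq H).
by rewrite /hd /GRing.scale/=; ring.
Qed.

(** Contains the ball and its translates along [e] by at most 1, so its indicator can dominate the
    translated functions and their derivatives. *)
Let cube : set 'rV[R]_n := [set y : 'rV[R]_n | forall i, y ord0 i \in `[(- 2%R)%R, 2%R]].

Let B_cube y (t : R) : `|t| <= 1 -> B (y + t *: e) -> cube y.
Proof.
move=> t1 /eball_enorm Bt j; rewrite in_itv/= -ler_norml.
have -> : y ord0 j = (y + t *: e) ord0 j - t * e ord0 j.
  by rewrite !mxE; ring.
apply: le_trans (ler_normB _ _) _; rewrite (_ : 2 = 1 + 1 :> R)//; apply: lerD.
  exact: le_trans (coord_le_enorm _ _) (ltW Bt).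
rewrite normrM; apply: mulr_ile1 => //.
by rewrite mxE; case: (_ && _) => /=; rewrite ?normr0 ?normr1.
Qed.

Lemma ball_integral_pderiv_sqr : IB (pd i ((1 - rho2 R n) ^+ 2 * g)) = 0.
Proof.
rewrite -/M.
have mB : measurable B by exact: measurable_eball.
have [C1 [C10 HC1]] := enorm_bounded_continuous 1 (@sfn_continuous _ _ (M ^+ 2 * g)).
have [C2 [C20 HC2]] := enorm_bounded_continuous 1 (@sfn_continuous _ _ (pd i (M ^+ 2 * g))).
pose F (t : R) y := h (y + t *: e).
pose D y := (C1 + C2) * \1_cube y.
have mcube : measurable cube by exact: measurable_cube.
have ID : leb.-integrable setT (EFin \o D).
  have -> : D = (cst (C1 + C2)) \_ cube.
    apply/funext => y; rewrite /D indicE patchE.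
    by case: (y \in cube); rewrite ?mulr1 ?mulr0.
  rewrite -restrict_EFin; apply/(integrable_mkcond _ mcube).
  apply: (@bounded_integrable _ _ _ _ mcube _ _ `|C1 + C2|) => //.
  exact: lebesgue_rV_cube_lty.
have D0 y : 0 <= D y by rewrite mulr_ge0// addr_ge0.
have hb y (t : R) : `|t| <= 1 -> `|h (y + t *: e)| <= D y.
  move=> t1; rewrite hE patchE; case: ifPn => [|_]; last by rewrite normr0.
  rewrite inE => By; rewrite /D indicE mem_set ?mulr1; last exact: B_cube By.
  by rewrite (le_trans (HC1 _ _))// ?lerDl//; exact: eball_le.
have hdb y (t : R) : `|t| <= 1 -> `|hd (y + t *: e)| <= D y.
  move=> t1; rewrite hdE patchE; case: ifPn => [|_]; last by rewrite normr0.
  rewrite inE => By; rewrite /D indicE mem_set ?mulr1; last exact: B_cube By.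
  by rewrite (le_trans (HC2 _ _))// ?lerDr//; exact: eball_le.
have mh : measurable_fun setT h.
  rewrite hE; apply/(measurable_restrict _ _ measurableT) => //; rewrite ?setTI.
  by apply: continuous_measurable_rV; exact: sfn_continuous.
have mF t : measurable_fun setT (F t).
  have := measurableT_comp mh (measurable_affine (t *: e) 1).
  by under eq_fun do rewrite /= scale1r addrC.
have IF t : `|t| <= 1 -> leb.-integrable setT (EFin \o F t).
  move=> t1; apply: (le_integrable measurableT _ _ ID).
    exact/measurable_EFinP.
  by move=> y _ /=; rewrite lee_fin (ger0_norm (D0 y)); exact: hb.
(* Translation invariance: the integral does not depend on [t], so its derivative at 0, which is the
   integral of [hd], vanishes. *)
have Fc t : \int[leb]_y F t y = \int[leb]_y F 0 y.
  have h0 : F 0 = h by apply/funext => y; rewrite /F scale0r addr0.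
  have I0 := IF 0; rewrite normr0 ler01 h0 in I0; move: I0 => /(_ isT) I0.
  rewrite h0 (@Rintegral_affine _ _ (t *: e) 1 setT h)// expr1n mul1r preimage_setT.
  by apply: eq_Rintegral => y _; rewrite scale1r addrC.
have partE t y : partial1of2 F t y = hd (y + t *: e).
  by rewrite /partial1of2 derive1E; have := dh y t => H; exact: derive_val.
have i0 : `](-1), 1[%classic (0 : R) by rewrite /= in_itv/=; apply/andP; split; lra.
have it t : `](-1), 1[%classic (t : R) -> `|t| <= 1.
  by rewrite /= in_itv/= => /andP[t1 t2]; rewrite ler_norml !ltW.
have H := @cvg_differentiation_under_integral _ _ _ leb F setT measurableT 0 (-1) 1 i0
  (fun t tI => IF t (it t tI)) (fun t y _ _ => @ex_derive _ _ _ _ _ _ _ (dh y t)) D D0 ID.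
have {}H := H (fun t y tI _ => eq_ind_r (fun z => `|z| <= D y) (hdb y t (it t tI)) (partE t y)).
have -> : IB (pd i (M ^+ 2 * g)) = \int[leb]_y partial1of2 F 0 y.
  rewrite Rintegral_mkcond -hdE; apply: eq_Rintegral => y _.
  by rewrite partE scale0r addr0.
have H0 : h^-1 *: (\int[leb]_y F (h + 0) y - \int[leb]_y F 0 y) @[h --> 0^'] --> (0 : R).
  under eq_fun do rewrite Fc subrr scaler0.
  exact: cvg_cst.
by rewrite -[LHS](cvg_lim _ H)//; exact: (cvg_lim _ H0).
Qed.
End line.

Lemma ball_sfnD f g : IB (f + g) = IB f + IB g.
Proof.
apply: sfn_integralD; [exact: measurable_eball0|exact: lebesgue_eball_lty|].
exact: eball_le.
Qed.

Lemma ball_sfnZ c f : IB (cstf c * f) = c * IB f.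
Proof.
apply: sfn_integralZ; [exact: measurable_eball0|exact: lebesgue_eball_lty|].
exact: eball_le.
Qed.

Lemma sphere_sfnD f g : IS (f + g) = IS f + IS g.
Proof.
apply: sfn_integralD; [exact: measurable_usphere|exact: sphere_measure_lty|].
exact: usphere_le.
Qed.

Lemma sphere_sfnZ c f : IS (cstf c * f) = c * IS f.
Proof.
apply: sfn_integralZ; [exact: measurable_usphere|exact: sphere_measure_lty|].
exact: usphere_le.
Qed.

Lemma sphere_sfn_eq f g : (forall y, S y -> f y = g y) -> IS f = IS g.
Proof. by move=> fg; apply: eq_Rintegral => y; rewrite inE => /fg. Qed.

Lemma ball_sfn0 : IB (0 : sfn) = 0.
Proof. by rewrite -[in LHS](mulr0 (cstf 0)) ball_sfnZ mul0r. Qed.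

Lemma sphere_sfn0 : IS (0 : sfn) = 0.
Proof. by rewrite -[in LHS](mulr0 (cstf 0)) sphere_sfnZ mul0r. Qed.

Lemma ball_sfn_sum (F : 'I_n -> sfn) : IB (\sum_i F i) = \sum_i IB (F i).
Proof.
elim/big_ind2: _ => [|f a g b <- <-|//]; [exact: ball_sfn0|exact: ball_sfnD].
Qed.

Let M_sphere y : S y -> M y = 0.
Proof. by move=> y1; rewrite /M sfnBE rho2E sfn1E y1 expr1n subrr. Qed.

Let sphere_M f : IS (M * f) = 0.
Proof.
rewrite -sphere_sfn0; apply: sphere_sfn_eq => y Sy.
by rewrite sfnME M_sphere// mul0r.
Qed.

Let pd_M i : pd i M = - 2 * X i.
Proof. by rewrite /M raddfB/= pd_rho2 pd1; ring. Qed.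

Let euler_M : euler M = 2 * M - 2.
Proof. by rewrite /M raddfB/= euler_rho2 euler1; ring. Qed.

Let const_nat (m : nat) : @cstf R n m%:R = m%:R.
Proof. exact: rmorph_nat. Qed.

(* The operator [n + 3 + euler] differentiates the identity
   [ball_integral_pderiv_sqr] with respect to the radius of the ball. *)
Lemma ball_integral_pderiv i g : IB (pd i (M * g)) = 0.
Proof.
have := @ball_integral_pderiv_sqr i ((N + 3) * g + euler g); rewrite -/M.
have -> : pd i (M ^+ 2 * ((N + 3) * g + euler g)) =
   cstf 4 * pd i (M * g) + ((N * (M ^+ 2 * pd i g) + euler (M ^+ 2 * pd i g))
    + cstf (- 4) * (N * (M * (X i * g)) + euler (M * (X i * g)))).
  rewrite rmorphN/= !const_nat expr2 !(pd_nat, pdM, pdD, eulerM, eulerD, pd_euler, euler_M, pd_M).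
  by rewrite euler_coord; ring.
(* Each term [N * f + euler f] becomes the sphere integral of an [f] divisible by [M], hence 0; only
   the multiple of [pd i (M * g)] remains. *)
rewrite !ball_sfnD !ball_sfnZ -!ball_sfnD -!sphere_ball_integral.
rewrite expr2 -[M * M * _]mulrA !sphere_M mulr0 !addr0 => /eqP.
by rewrite mulf_eq0 pnatr_eq0 => /eqP.
Qed.

(** The constant in [M * ((N + 1) * F i + euler (F i))] is chosen so that [pd i M = - 2 * X i]
    produces exactly [N * radial F + euler (radial F)], the ball form of the boundary term. The part
    with [M] in front leaves [2 * div F] and a sphere integral containing [M]. *)
Theorem ball_divergence (F : 'I_n -> sfn) : IB (div F) = IS (radial F).
Proof.
have : IB (div (fun i => M * ((N + 1) * F i + euler (F i)))) = 0.
  by rewrite /div ball_sfn_sum big1// => i _; exact: ball_integral_pderiv.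
have -> : div (fun i => M * ((N + 1) * F i + euler (F i))) =
    cstf 2 * div F + (cstf (- 2) * (N * radial F + euler (radial F))
    + (N * (M * div F) + euler (M * div F))).
  rewrite rmorphN/= !const_nat divM eulerM euler_M euler_radial.
  have -> : div (fun i => (N + 1) * F i + euler (F i)) = (N + 2) * div F + euler (div F).
    rewrite {1}/div; under eq_bigr => i _ do rewrite pdD pdM pdD !pd_nat ?pd1.
    rewrite big_split/= -[X in _ + X = _]/(div (fun i => euler (F i))) div_euler.
    under eq_bigr => i _ do rewrite addr0 mul0r add0r.
    by rewrite -mulr_sumr -/(div F); ring.
  have -> : \sum_(i < n) pd i M * ((N + 1) * F i + euler (F i)) =
      - 2 * ((N + 1) * radial F + radial (fun i => euler (F i))).
    rewrite /radial !mulr_sumr -big_split mulr_sumr; apply: eq_bigr => i _.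
    by rewrite /= pd_M; ring.
  by ring.
rewrite !ball_sfnD !ball_sfnZ -!ball_sfnD -!sphere_ball_integral sphere_M addr0.
by move/eqP; rewrite mulNr subr_eq0 => /eqP /mulfI; apply; rewrite pnatr_eq0.
Qed.

(** Written over the ball, the integrand is the divergence of [(N - 1) * F i + euler (F i)], which
    is again tangent to the spheres, so the divergence theorem gives a zero boundary term. *)
Theorem sphere_divergence (F : 'I_n -> sfn) : radial F = 0 -> IS (div F) = 0.
Proof.
move=> F0; rewrite sphere_ball_integral.
have -> : N * div F + euler (div F) = div (fun i => (N - 1) * F i + euler (F i)).
  rewrite [RHS]/div; under eq_bigr => i _ do rewrite pdD pdM pdB !pd_nat ?pd1.
  rewrite big_split/= -[X in _ = _ + X]/(div (fun i => euler (F i))) div_euler.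
  under eq_bigr => i _ do rewrite subr0 mul0r add0r.
  by rewrite -mulr_sumr -/(div F); ring.
rewrite ball_divergence -[RHS]sphere_sfn0; congr (Rintegral _ _ (sfn_val _)).
have H : radial (fun i => euler (F i)) = 0.
  by have := euler_radial F; rewrite F0 raddf0 add0r => <-.
rewrite -[RHS]addr0 -[X in _ = _ + X]H -[X in _ = X + _](mulr0 (N - 1)) -F0.
rewrite /radial mulr_sumr -big_split; apply: eq_bigr => i _.
by rewrite /=; ring.
Qed.

(** The integrand is the divergence of [g] times the tangential gradient of [f], normalised by
    [rho2] to be defined off the sphere. *)
Theorem sphere_green f g : IS (g * angL f + angG g f) = 0.
Proof.
pose F i := g * (rho2 R n * pd i f - X i * euler f).
have <- : div F = g * angL f + angG g f.
  rewrite /F divM.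
  have -> : div (fun i => rho2 R n * pd i f - X i * euler f) = angL f.
    rewrite /div; under eq_bigr => i _ do rewrite pdB !pdM pd_rho2 pd_coord eqxx mulr1n mul1r pd_euler.
    rewrite (_ : \sum_(i < n) _ = \sum_(i < n) (2 * (X i * pd i f) + rho2 R n * pd i (pd i f)
       - euler f - X i * pd i f - X i * euler (pd i f))); last first.
      by apply: eq_bigr => i _; ring.
    have E : \sum_(i < n) X i * euler (pd i f) = euler (euler f) - euler f.
      have -> : euler (euler f) = \sum_(i < n) euler (X i * pd i f) by exact: euler_sum.
      rewrite [Y in _ - Y]/euler -sumrB; apply: eq_bigr => i _.
      by rewrite eulerM euler_coord; ring.
    rewrite !sumrB big_split/= -!mulr_sumr E sumr_const card_ord -/(euler f) -/(lap f).
    by rewrite -mulr_natl /angL; ring.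
  rewrite addrC; congr (_ + _); rewrite /angG /gdot /euler mulr_sumr mulr_suml -sumrB.
  by apply: eq_bigr => i _; rewrite -/(euler f); ring.
apply: sphere_divergence; rewrite /radial.
rewrite (eq_bigr (fun i => (g * rho2 R n) * (X i * pd i f) - (g * euler f) * X i ^+ 2)).
  by rewrite sumrB -!mulr_sumr -/(rho2 R n) -/(euler f); ring.
by move=> i _; rewrite /F; ring.
Qed.

Lemma sphere_angL_sym f g : IS (g * angL f - f * angL g) = 0.
Proof.
have -> : g * angL f - f * angL g = (g * angL f + angG g f) +
    cstf (- 1) * (f * angL g + angG f g).
  by rewrite rmorphN1 (angGC f g); ring.
by rewrite sphere_sfnD sphere_sfnZ !sphere_green mulr0 addr0.
Qed.

End divergence.

(** * The monotonicity formula *)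

Section monotonicity_identity.
Context (R : realType) (n : nat) (p : R) (v : sfn R n).
Local Notation sfn := (sfn R n).
Local Notation k := (kexp p).
Implicit Types (f g h : sfn) (c : R).

Lemma cstfE c (y : 'rV[R]_n) : cstf c y = c. Proof. by []. Qed.

Lemma sfn_natE (m : nat) (y : 'rV[R]_n) : (m%:R : sfn) y = m%:R.
Proof. by rewrite sfnMnE. Qed.

Lemma euler_cstfM c f : euler (cstf c * f) = cstf c * euler f.
Proof. by rewrite eulerM euler_const mul0r add0r. Qed.

Lemma pd_cstfM i c f : pd i (cstf c * f) = cstf c * pd i f.
Proof. by rewrite pdM pd_const mul0r add0r. Qed.

Lemma lap_cstfM c f : lap (cstf c * f) = cstf c * lap f.
Proof.
by rewrite /lap mulr_sumr; apply: eq_bigr => i _; rewrite !pd_cstfM.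
Qed.

Lemma angL_cstfM c f : angL (cstf c * f) = cstf c * angL f.
Proof. by rewrite /angL lap_cstfM !euler_cstfM; ring. Qed.

Lemma angLD f g : angL (f + g) = angL f + angL g. Proof. exact: raddfD. Qed.

Lemma nlap_cstfM c f : nlap (cstf c * f) = cstf c * nlap f.
Proof. by rewrite /nlap lap_cstfM; ring. Qed.

Lemma gdotDl f g h : gdot (f + g) h = gdot f h + gdot g h.
Proof. by rewrite /gdot -big_split; apply: eq_bigr => i _; rewrite /= pdD mulrDl. Qed.

Lemma gdot_cstfMl c f h : gdot (cstf c * f) h = cstf c * gdot f h.
Proof. by rewrite /gdot mulr_sumr; apply: eq_bigr => i _; rewrite pd_cstfM mulrA. Qed.

Lemma angGDl f g h : angG (f + g) h = angG f h + angG g h.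
Proof.
by rewrite /angG eulerD gdotDl; ring.
Qed.

Lemma angG_cstfMl c f h : angG (cstf c * f) h = cstf c * angG f h.
Proof.
by rewrite /angG euler_cstfM gdot_cstfMl; ring.
Qed.

Lemma angGDr f g h : angG h (f + g) = angG h f + angG h g.
Proof. by rewrite angGC angGDl ![angG _ h]angGC. Qed.

Lemma angG_cstfMr c f h : angG h (cstf c * f) = cstf c * angG h f.
Proof. by rewrite angGC angG_cstfMl angGC. Qed.

(* The [m]-th derivative of [l `^ k * v (l *: y)] in [l] is [l `^ (k - m%:R) * V m (l *: y)]. *)
Fixpoint V_rec (m : nat) : sfn :=
  if m is j.+1 then cstf (k - j%:R) * V_rec j + euler (V_rec j) else v.

(** Locked, so that each [V m] stays an atom for [rewrite] and [ring] instead of unfolding into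
    Euler derivatives. *)
Definition V : nat -> sfn := locked V_rec.

Lemma V0 : V 0 = v. Proof. by rewrite /V -lock. Qed.

Lemma VS m : V m.+1 = cstf (k - m%:R) * V m + euler (V m).
Proof. by rewrite /V -lock. Qed.

Local Notation A m := (angL (V m)).
Local Notation AA m := (angL (angL (V m))).

Lemma euler_V m : euler (V m) = V m.+1 + cstf (m%:R - k) * V m.
Proof.
by rewrite VS -opprB rmorphN; ring.
Qed.

Lemma euler_AV m : euler (A m) = A m.+1 + cstf (m%:R - k) * A m.
Proof. by rewrite euler_angL euler_V angLD angL_cstfM. Qed.

Lemma euler_angGV i j : euler (angG (V i) (V j)) =
  angG (V i.+1) (V j) + angG (V i) (V j.+1) + cstf (i%:R + j%:R - 2 * k) * angG (V i) (V j).
Proof.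
rewrite euler_angG !euler_V !(angGDl, angGDr, angG_cstfMl, angG_cstfMr).
ring.
Qed.

Lemma nlap_V m : nlap (V m) = V m.+2 + cstf (2 * (m%:R - k) + n%:R - 1) * V m.+1
  + cstf ((m%:R - k) * (m%:R - k + n%:R - 2)) * V m + A m.
Proof.
rewrite euler_angLE euler_V eulerD euler_cstfM !euler_V.
by apply/sfnP => y; rewrite !(sfnDE, sfnBE, sfnNE, sfnME, cstfE, sfn_natE) -!natr1; ring.
Qed.

Lemma euler_nlap_V m : euler (nlap (V m)) = nlap (V m.+1) + cstf (m%:R - k) * nlap (V m).
Proof. by rewrite euler_nlap euler_V /nlap raddfD /= lap_cstfM; ring. Qed.

Lemma angL_nlap_V m : angL (nlap (V m)) = A m.+2 + cstf (2 * (m%:R - k) + n%:R - 1) * A m.+1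
  + cstf ((m%:R - k) * (m%:R - k + n%:R - 2)) * A m + AA m.
Proof. by rewrite nlap_V !angLD !angL_cstfM. Qed.

Lemma euler_angL_nlap_V m : euler (angL (nlap (V m))) =
  angL (nlap (V m.+1)) + cstf (m%:R - k) * angL (nlap (V m)).
Proof. by rewrite euler_angL euler_nlap_V angLD angL_cstfM. Qed.

(* [t * d/dt] maps [t `^ c * f (t *: y)] to [t `^ c * theta c f (t *: y)]. *)
Definition theta (c : R) (f : sfn) : sfn := cstf c * f + euler f.

Lemma thetaD c f g : theta c (f + g) = theta c f + theta c g.
Proof. by rewrite /theta eulerD; ring. Qed.

Lemma theta_cstfM c a f : theta c (cstf a * f) = cstf a * theta c f.
Proof. by rewrite /theta euler_cstfM; ring. Qed.

Lemma thetaM f g f' g' (a b c : R) : euler f = f' + cstf a * f -> euler g = g' + cstf b * g ->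
  theta c (f * g) = f' * g + f * g' + cstf (c + a + b) * (f * g).
Proof.
move=> fE gE; rewrite /theta eulerM fE gE.
ring.
Qed.

Lemma theta_angGV i j : theta (2 * k) (angG (V i) (V j)) =
  angG (V i.+1) (V j) + angG (V i) (V j.+1) + cstf (i%:R + j%:R) * angG (V i) (V j).
Proof.
rewrite /theta euler_angGV.
ring.
Qed.

(** The boundary integrand of the energy with all powers of the radius removed and its derivatives
    of squares expanded: the half derivative of the squared spherical Laplacian becomes [A 0 * A 1].
    The nesting to the right lets [thetaD] split the fifteen terms. *)
Definition bdry_sfn : sfn :=
  cstf ((k + 2) / 2) * (nlap (V 0) * nlap (V 0))
  + (cstf (-1) * (V 4 * V 1)
  + (cstf 2 * (V 3 * V 2)
  + (cstf (6 - delta1 n p) * (V 3 * V 1)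
  + (cstf (- (24 - 6 * delta1 n p + delta2 n p)) * (V 2 * V 1)
  + (cstf (- (9 * delta1 n p - 3 * delta2 n p - 36)) * (V 1 * V 1)
  + (cstf (delta1 n p - 8) * (V 2 * V 2)
  + (cstf (delta4 n p) * (V 0 * V 1)
  + (cstf (2 * delta4 n p) * (V 0 * V 0)
  + (cstf 2 * (A 0 * A 0)
  + (cstf 1 * (A 0 * A 1)
  + (cstf (- 4 * (beta n p - n%:R + 4)) * angG (V 0) (V 0)
  + (cstf (- 2 * (beta n p - n%:R + 4)) * angG (V 0) (V 1)
  + (cstf (- 6) * angG (V 1) (V 1)
  + cstf 2 * angG (V 1) (V 2)))))))))))))).

Lemma theta_bdry : theta (2 * k) bdry_sfn =
  cstf (k + 2) * (nlap (V 1) * nlap (V 0))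
  + (cstf (-1) * (V 5 * V 1 + V 4 * V 2 + cstf 5 * (V 4 * V 1))
  + (cstf 2 * (V 4 * V 2 + V 3 * V 3 + cstf 5 * (V 3 * V 2))
  + (cstf (6 - delta1 n p) * (V 4 * V 1 + V 3 * V 2 + cstf 4 * (V 3 * V 1))
  + (cstf (- (24 - 6 * delta1 n p + delta2 n p)) * (V 3 * V 1 + V 2 * V 2 + cstf 3 * (V 2 * V 1))
  + (cstf (- (9 * delta1 n p - 3 * delta2 n p - 36)) * (cstf 2 * (V 2 * V 1) + cstf 2 * (V 1 * V 1))
  + (cstf (delta1 n p - 8) * (cstf 2 * (V 3 * V 2) + cstf 4 * (V 2 * V 2))
  + (cstf (delta4 n p) * (V 1 * V 1 + V 0 * V 2 + V 0 * V 1)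
  + (cstf (2 * delta4 n p) * (cstf 2 * (V 0 * V 1))
  + (cstf 2 * (cstf 2 * (A 0 * A 1))
  + (cstf 1 * (A 1 * A 1 + A 0 * A 2 + A 0 * A 1)
  + (cstf (- 4 * (beta n p - n%:R + 4)) * (cstf 2 * angG (V 0) (V 1))
  + (cstf (- 2 * (beta n p - n%:R + 4)) * (angG (V 1) (V 1) + angG (V 0) (V 2) + angG (V 0) (V 1))
  + (cstf (- 6) * (cstf 2 * angG (V 1) (V 2) + cstf 2 * angG (V 1) (V 1))
  + cstf 2 * (angG (V 2) (V 2) + angG (V 1) (V 3) + cstf 3 * angG (V 1) (V 2))))))))))))))).
Proof.
(* The weight [2 * k] cancels the [- k] of each factor in [euler_V], leaving the orders [i] and
   [j]. *)
have VM i j : theta (2 * k) (V i * V j) =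
    V i.+1 * V j + V i * V j.+1 + cstf (i%:R + j%:R) * (V i * V j).
  rewrite (thetaM _ (euler_V i) (euler_V j)).
  ring.
have AM i j : theta (2 * k) (A i * A j) =
    A i.+1 * A j + A i * A j.+1 + cstf (i%:R + j%:R) * (A i * A j).
  rewrite (thetaM _ (euler_AV i) (euler_AV j)).
  ring.
have NM : cstf ((k + 2) / 2) * theta (2 * k) (nlap (V 0) * nlap (V 0)) =
    cstf (k + 2) * (nlap (V 1) * nlap (V 0)).
  rewrite (thetaM _ (euler_nlap_V 0) (euler_nlap_V 0)).
  by apply/sfnP => y; rewrite !(sfnDE, sfnME, cstfE); field.
have GM := theta_angGV.
rewrite /bdry_sfn 14!thetaD !theta_cstfM NM !VM !AM !GM.
rewrite ![angG (V 1) (V 0)]angGC [angG (V 2) (V 1)]angGC.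
by ring.
Qed.

Definition diss_sfn : sfn :=
  (cstf 2 * V 3 ^+ 2
   + cstf (10 * delta1 n p - 2 * delta2 n p - 56) * V 2 ^+ 2
   + cstf (- 18 * delta1 n p + 6 * delta2 n p - 4 * delta3 n p
           + 2 * delta4 n p + 72) * V 1 ^+ 2)
  + (cstf 4 * angG (V 2) (V 2)
   + cstf (8 * alpha n p - 4 * beta n p + 4 * n%:R - 28) * angG (V 1) (V 1))
  + cstf 2 * A 1 ^+ 2 + nlap (V 1) ^+ 2.

(* [rho2 ^+ 2 * lap (lap v)] and the radial component of the flux, both scaled to degree 0. *)
Definition bilap : sfn :=
  euler (euler (nlap (V 0))) + cstf (n%:R - 6) * euler (nlap (V 0))
  + cstf (8 - 2 * n%:R) * nlap (V 0) + angL (nlap (V 0)).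

Definition flux : sfn :=
  nlap (V 1) * (euler (nlap (V 0)) - cstf 2 * nlap (V 0))
  - bilap * euler (V 1) + V 1 * (euler bilap - cstf 4 * bilap).

Lemma bilapE : bilap = nlap (V 2) + cstf (n%:R - 5 - 2 * k) * nlap (V 1)
  + cstf (k ^+ 2 - k * (n%:R - 6) + 8 - 2 * n%:R) * nlap (V 0) + angL (nlap (V 0)).
Proof.
rewrite /bilap euler_nlap_V eulerD euler_cstfM !euler_nlap_V.
ring.
Qed.

Lemma euler_bilap : euler bilap = nlap (V 3) + cstf (n%:R - 3 - 3 * k) * nlap (V 2)
  + cstf ((n%:R - 5 - 2 * k) * (1 - k) + (k ^+ 2 - k * (n%:R - 6) + 8 - 2 * n%:R)) * nlap (V 1)
  + cstf (- k * (k ^+ 2 - k * (n%:R - 6) + 8 - 2 * n%:R)) * nlap (V 0)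
  + angL (nlap (V 1)) + cstf (- k) * angL (nlap (V 0)).
Proof.
rewrite bilapE 3!eulerD !euler_cstfM !euler_nlap_V euler_angL_nlap_V.
ring.
Qed.

(** The two integrations by parts on the sphere: [green_sfn] trades [V i * A j] for
    [- angG (V i) (V j)], and [sym_sfn] trades [V i * AA j] for [A j * A i]. *)
Definition green_sfn j i : sfn := V i * A j + angG (V i) (V j).
Definition sym_sfn j i : sfn := V i * AA j - A j * A i.

(* The integrals of [green_sfn] and [sym_sfn] over spheres centred at 0 vanish. *)
Lemma monotonicity_identity :
  flux + theta (2 * k) bdry_sfn =
  diss_sfn + (cstf 2 * green_sfn 3 1 + cstf (2 * alpha n p - 6) * green_sfn 2 1
  + cstf (2 * (beta n p - n%:R + 4) - 8 * alpha n p) * green_sfn 1 1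
  + cstf (- 10 * (beta n p - n%:R + 4)) * green_sfn 0 1 + cstf (- 2) * green_sfn 2 2
  + cstf (- 2 * alpha n p) * green_sfn 1 2 + cstf (- 2 * (beta n p - n%:R + 4)) * green_sfn 0 2
  + sym_sfn 1 1 + cstf (-1) * sym_sfn 0 2 + cstf (-5) * sym_sfn 0 1).
Proof.
rewrite theta_bdry /flux euler_bilap bilapE euler_nlap_V euler_V /diss_sfn /green_sfn /sym_sfn.
rewrite !angL_nlap_V !nlap_V [angG (V 2) (V 1)]angGC.
rewrite [angG (V 1) (V 0)]angGC [angG (V 2) (V 0)]angGC.
rewrite /alpha /beta /delta1 /delta2 /delta3 /delta4.
move: (kexp p) (n%:R : R) => K N.
(* Outer operators are generalised before inner ones; every [angG], iterated [angL], [angL] and [V]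
   becomes an independent variable, so no further relation between them enters the identity. *)
repeat match goal with |- context [angG ?a ?b] => move: (angG a b) => ? end.
repeat match goal with |- context [angL (angL ?a)] => move: (angL (angL a)) => ? end.
repeat match goal with |- context [angL ?a] => move: (angL a) => ? end.
repeat match goal with |- context [V ?a] => move: (V a) => ? end.
ring.
Qed.

End monotonicity_identity.

(** * Translation of the concrete operators into the algebra of smooth functions *)

Section dictionary.
Context (R : realType) (n : nat).
Local Notation sfn := (sfn R n).
Implicit Types (f g : sfn) (y : 'rV[R]_n) (a t l : R).

Lemma laplacian_sfn f : laplacian f = lap f :> (_ -> _).
Proof. by apply/funext => y; rewrite /laplacian /lap sfn_sumE. Qed.

Lemma dotv_grad f y : dotv (grad f y) y = euler f y.
Proof.
by rewrite /dotv /euler sfn_sumE; apply: eq_bigr => i _; rewrite sfnME mxE mulrC.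
Qed.

Lemma enorm_grad f y : enorm (grad f y) ^+ 2 = gdot f f y.
Proof.
by rewrite sqr_enorm /dotv /gdot sfn_sumE; apply: eq_bigr => i _; rewrite sfnME !mxE.
Qed.

Lemma sgrad_sfnE f y i :
  sgrad f y ord0 i = (pd i f - euler f * xcoord i) y.
Proof. by rewrite /sgrad dotv_grad !mxE. Qed.

Lemma usphere_rho2 y : usphere R n y -> rho2 R n y = 1.
Proof. by move=> Sy; rewrite rho2E Sy expr1n. Qed.

Lemma enorm_sgrad f y : usphere R n y -> enorm (sgrad f y) ^+ 2 = angG f f y.
Proof.
move=> Sy; rewrite sqr_enorm /dotv.
under eq_bigr => i _ do rewrite !sgrad_sfnE -sfnME.
rewrite -sfn_sumE (_ : \sum_(i < n) _ = gdot f f - 2 * euler f * euler f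
   + euler f * euler f * rho2 R n); last first.
  have -> : 2 * euler f * euler f = \sum_(i < n) 2 * euler f * (xcoord i * pd i f).
    by rewrite -mulr_sumr.
  rewrite /gdot /rho2 [_ * \sum_(i < n) xcoord i ^+ 2]mulr_sumr -sumrB -big_split.
  by apply: eq_bigr => i _; rewrite /=; ring.
rewrite /angG !(sfn_natE, sfnDE, sfnBE, sfnNE, sfnME) usphere_rho2//; ring.
Qed.

(** [sdiv] differentiates [sgrad f], so the computation is carried out off the sphere with [rho2]
    kept as a factor, and [rho2 = 1] is substituted only at the end. *)
Lemma slaplacian_sfn f y : usphere R n y -> slaplacian f y = angL f y.
Proof.
move=> Sy; rewrite /slaplacian /sdiv.
pose h i := pd i f - euler f * xcoord i.
have hE i : (fun z => sgrad f z ord0 i) = h i.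
  by apply/funext => z; rewrite sgrad_sfnE.
under eq_bigr => i _ do rewrite hE sgrad_sfnE.
rewrite -sfn_sumE (_ : \sum_(i < n) _ = lap f - n%:R * euler f - 2 * euler (euler f)
   + euler f + rho2 R n * euler (euler f) + rho2 R n * euler f); last first.
  have E1 : euler (euler f) = euler f + \sum_(i < n) xcoord i * euler (pd i f).
    have -> : euler (euler f) = \sum_(i < n) euler (xcoord i * pd i f) by exact: euler_sum.
    rewrite [Y in _ = Y + _]/euler -big_split; apply: eq_bigr => i _.
    by rewrite eulerM euler_coord.
  have E2 : \sum_(i < n) xcoord i * pd i (euler f) = euler (euler f) by [].
  transitivity (\sum_(i < n) (pd i (pd i f) - euler f - xcoord i * pd i (euler f)
     - xcoord i * euler (pd i f) + xcoord i ^+ 2 * (euler (euler f) + euler f))).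
    apply: eq_bigr => i _; rewrite /h pdB pdM pd_coord eqxx mulr1n eulerB eulerM euler_coord.
    ring.
  rewrite !(big_split, sumrN)/= -!mulr_suml E2 -/(rho2 R n) -/(lap f).
  have -> : \sum_(i < n) xcoord i * euler (pd i f) = euler (euler f) - euler f.
    by rewrite E1 addrAC subrr add0r.
  by rewrite sumr_const card_ord -mulr_natl; ring.
rewrite /angL !(sfn_natE, sfnDE, sfnBE, sfnNE, sfnME) usphere_rho2//; ring.
Qed.

Definition famS a g t : sfn := cstf (t `^ a) * dil t g.

Lemma famSE a g t y : famS a g t y = t `^ a * g (t *: y). Proof. by []. Qed.

Lemma powR_addn t a (m : nat) : 0 < t -> t `^ (a + m%:R) = t `^ a * t ^+ m.
Proof. by move=> t0; rewrite powRD ?(gt_eqF t0) ?implybT// powR_mulrn// ltW. Qed.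

Lemma powR_subn t a (m : nat) : 0 < t -> t `^ (a - m%:R) = t `^ a / t ^+ m.
Proof. by move=> t0; rewrite powRB ?(gt_eqF t0) ?implybT// powR_mulrn// ltW. Qed.

Lemma is_derive_famS a g t y : 0 < t ->
  is_derive t 1 (fun s => famS a g s y) (t^-1 * famS a (theta a g) t y).
Proof.
move=> t0; have H1 := is_derive1_powR a t0.
have H2 := @is_derive_dilation _ _ g y t (lt0r_neq0 t0).
have H := is_deriveM H1 H2; apply: (is_derive_eq H).
rewrite famSE /theta sfnDE sfnME cstfE /GRing.scale/= -[a - 1]/(a - 1%:R) powR_subn// expr1.
by field; rewrite gt_eqF.
Qed.

Lemma famS_succ a g t : 0 < t -> famS (a + 1) g t = cstf t * famS a g t.
Proof.
by move=> t0; rewrite /famS (powR_addn a 1 t0) expr1 rmorphM/=; ring.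
Qed.

(** The closed forms with powers of the parameter are established for positive values; since
    derivatives are local, that is enough to differentiate them. *)
Lemma is_derive_near_pos (W : normedModType R) (f g : R -> W) l (d : W) : 0 < l ->
  (forall s, 0 < s -> f s = g s) -> is_derive l 1 g d -> is_derive l 1 f d.
Proof.
move=> l0 fg; apply: near_eq_is_derive.
by near=> s; apply/esym/fg; near: s; exact: lt_nbhsr.
Unshelve. all: by end_near. Qed.

Lemma is_derive_rV (F : R -> 'rV[R]_n) (D : 'rV[R]_n) (t : R) :
  (forall i, is_derive t 1 (fun s => F s ord0 i) (D ord0 i)) -> is_derive t 1 F D.
Proof.
move=> H; have dF : derivable F t 1.
  by apply/derivable_mxP => i j; rewrite (ord1 i); exact: (@ex_derive _ _ _ _ _ _ _ (H j)).
apply: DeriveDef => //; rewrite derive_mx//; apply/rowP => j.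
by rewrite mxE (@derive_val _ _ _ _ _ _ _ (H j)).
Qed.

End dictionary.

(** * Moving the centre of the balls to the origin *)

Section translation.
Context (R : realType) (n : nat) (x : 'rV[R]_n).
Local Notation sfn := (sfn R n).
Implicit Types f g : sfn.

Lemma smooth_translation f : smooth (fun y : 'rV[R]_n => f (x + y)).
Proof.
have := smooth_affine 1 x (smooth_sfn f).
by under eq_fun do rewrite scale1r.
Qed.

Definition trans f : sfn := mksfn (smooth_translation f).

Lemma transE f y : trans f y = f (x + y). Proof. by []. Qed.

Lemma pd_trans i f : pd i (trans f) = trans (pd i f).
Proof.
apply/sfnP => y /=; have := pderiv_affine i 1 x (sfn_differentiable f).
under eq_fun do rewrite scale1r.
by move=> ->; rewrite /GRing.mul/= scale1r mul1r.
Qed.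

Lemma lap_trans f : lap (trans f) = trans (lap f).
Proof.
apply/sfnP => y; rewrite transE /lap !sfn_sumE; apply: eq_bigr => i _.
by rewrite !pd_trans.
Qed.

Lemma gdot_trans f g : gdot (trans f) (trans g) = trans (gdot f g).
Proof.
apply/sfnP => y; rewrite transE /gdot !sfn_sumE; apply: eq_bigr => i _.
by rewrite !pd_trans.
Qed.

End translation.

(** * Operators and integrals on weighted dilation families *)

Section families.
Context (R : realType) (n : nat).
Local Notation sfn := (sfn R n).
Implicit Types (f g : sfn) (y : 'rV[R]_n) (a t l : R).

Lemma powR_double t a : t `^ (2 * a) = t `^ a ^+ 2.
Proof. by rewrite mulrC powRrM powR_mulrn// powR_ge0. Qed.

Lemma nlap_dil t g : nlap (dil t g) = dil t (nlap g).
Proof. by rewrite /nlap lap_dil rmorphM/= dil_rho2; ring. Qed.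

Lemma nlap_famS a g t : nlap (famS a g t) = famS a (nlap g) t.
Proof. by rewrite /famS nlap_cstfM nlap_dil. Qed.

Lemma angL_famS a g t : angL (famS a g t) = famS a (angL g) t.
Proof. by rewrite /famS angL_cstfM angL_dil. Qed.

Lemma angG_famS a f g t :
  angG (famS a f t) (famS a g t) = famS (2 * a) (angG f g) t.
Proof.
rewrite /famS angG_cstfMl angG_cstfMr angG_dil powR_double rmorphXn/=; ring.
Qed.

Lemma laplacian_sphere f y : usphere R n y -> laplacian f y = nlap f y.
Proof. by move=> Sy; rewrite laplacian_sfn /nlap sfnME usphere_rho2// mul1r. Qed.

Lemma is_derive_famS_integral (mu : {measure set 'rV[R]_n -> \bar R}) (E : set 'rV[R]_n)
    a (g : sfn) l : measurable E -> (mu E < +oo)%E -> (forall y, E y -> enorm y <= 1) ->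
  0 < l ->
  is_derive l 1 (fun t => t `^ a * \int[mu]_(y in E) dil t g y)
    (l^-1 * (l `^ a * \int[mu]_(y in E) dil l (theta a g) y)).
Proof.
move=> mE fE bE l0.
have H := is_deriveM (is_derive1_powR a l0) (is_derive_integral_dilation mE fE bE g l0).
apply: (is_derive_eq H).
have -> : dil l (theta a g) = cstf a * dil l g + dil l (euler g).
  by rewrite /theta rmorphD rmorphM/= dil_const.
rewrite (sfn_integralD mE fE bE) (sfn_integralZ mE fE bE).
rewrite /GRing.scale/= -[a - 1]/(a - 1%:R) powR_subn// expr1.
by field; rewrite gt_eqF.
Qed.

End families.

(** * The boundary integrand as a weighted dilation family *)

Section boundary.
Context (R : realType) (n : nat) (p : R) (u : 'rV[R]_n -> R) (x : 'rV[R]_n).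
Hypothesis su : smooth u.
Local Notation sfn := (sfn R n).
Local Notation k := (kexp p).
Local Notation S := (usphere R n).
Let v : sfn := trans x (mksfn su).
Local Notation V := (V p v).
Implicit Types (y : 'rV[R]_n) (t l : R).

Lemma scaledE t : scaled p u x t = famS k (V 0) t :> (_ -> _).
Proof. by rewrite V0. Qed.

Lemma dscaledE m t : 0 < t -> dscaled p u x m t = famS (k - m%:R) (V m) t :> (_ -> _).
Proof.
move=> t0; apply/funext => y; rewrite /dscaled.
elim: m t t0 => [|m IH] t t0.
  by rewrite derive1n0 subr0 -scaledE.
rewrite derive1nS derive1E.
have H := is_derive_near_pos t0 IH (is_derive_famS (k - m%:R) (V m) y t0).
rewrite (@derive_val _ _ _ _ _ _ _ H) !famSE /theta -VS.
by rewrite -natr1 opprD addrA (powR_subn (k - m%:R) 1 t0) expr1; ring.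
Qed.

Lemma dscaled_val m t y : 0 < t ->
  dscaled p u x m t y = t `^ k / t ^+ m * V m (t *: y).
Proof. by move=> t0; rewrite dscaledE// famSE powR_subn. Qed.

Lemma derive_laplacian_scaled l y : 0 < l -> S y ->
  derive1 (fun t => laplacian (scaled p u x t) y) l = l^-1 * (l `^ k * nlap (V 1) (l *: y)).
Proof.
move=> l0 Sy; rewrite derive1E.
have H := is_derive_famS k (nlap (V 0)) y l0.
have {}H : is_derive l 1 (fun t => laplacian (scaled p u x t) y)
    (l^-1 * famS k (theta k (nlap (V 0))) l y).
  apply: is_derive_near_pos H => // s s0.
  by rewrite scaledE laplacian_sphere// nlap_famS.
rewrite (@derive_val _ _ _ _ _ _ _ H) famSE; congr (_ * (_ * sfn_val _ _)).
by rewrite /theta euler_nlap_V sub0r rmorphN; ring.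
Qed.

Lemma derive_slaplacian_scaled l y : 0 < l -> S y ->
  is_derive l 1 (fun t => slaplacian (scaled p u x t) y) (l^-1 * (l `^ k * angL (V 1) (l *: y))).
Proof.
move=> l0 Sy; have H := is_derive_famS k (angL (V 0)) y l0.
have {}H : is_derive l 1 (fun t => slaplacian (scaled p u x t) y)
    (l^-1 * famS k (theta k (angL (V 0))) l y).
  apply: is_derive_near_pos H => // s s0.
  by rewrite scaledE slaplacian_sfn// angL_famS.
apply: (is_derive_eq H); rewrite famSE; congr (_ * (_ * sfn_val _ _)).
by rewrite /theta euler_AV sub0r rmorphN; ring.
Qed.

Lemma derive_sqr_slaplacian l y : 0 < l -> S y ->
  derive1 (fun t => slaplacian (scaled p u x t) y ^+ 2) l =
  l^-1 * (l `^ k ^+ 2 * (2 * angL (V 0) (l *: y) * angL (V 1) (l *: y))).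
Proof.
move=> l0 Sy; have H := derive_slaplacian_scaled l0 Sy.
rewrite derive1E (_ : (fun t => _) =
  (fun t => slaplacian (scaled p u x t) y) * (fun t => slaplacian (scaled p u x t) y)); last first.
  by apply/funext => t; rewrite expr2.
have H2 := is_deriveM H H; rewrite (@derive_val _ _ _ _ _ _ _ H2).
by rewrite scaledE slaplacian_sfn// angL_famS famSE /GRing.scale/=; ring.
Qed.

Lemma derive_sqr_sgrad m l y : 0 < l -> S y ->
  derive1 (fun t => enorm (sgrad (dscaled p u x m t) y) ^+ 2) l =
  l^-1 * (l `^ k ^+ 2 / l ^+ m ^+ 2 * (2 * angG (V m) (V m.+1) (l *: y))).
Proof.
move=> l0 Sy; rewrite derive1E.
have H := is_derive_famS (2 * (k - m%:R)) (angG (V m) (V m)) y l0.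
have {}H : is_derive l 1 (fun t => enorm (sgrad (dscaled p u x m t) y) ^+ 2)
    (l^-1 * famS (2 * (k - m%:R)) (theta (2 * (k - m%:R)) (angG (V m) (V m))) l y).
  apply: is_derive_near_pos H => // s s0.
  by rewrite dscaledE// enorm_sgrad// angG_famS.
rewrite (@derive_val _ _ _ _ _ _ _ H) famSE powR_double powR_subn// expr_div_n.
congr (_ * (_ * _)).
have -> : theta (2 * (k - m%:R)) (angG (V m) (V m)) = 2 * angG (V m) (V m.+1).
  by rewrite /theta euler_angGV [angG (V m.+1) _]angGC; ring.
by rewrite sfnME sfn_natE.
Qed.

Lemma enorm_sgrad_dscaled m t y : 0 < t -> S y ->
  enorm (sgrad (dscaled p u x m t) y) ^+ 2 = t `^ k ^+ 2 / t ^+ m ^+ 2 * angG (V m) (V m) (t *: y).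
Proof.
move=> t0 Sy; rewrite dscaledE// enorm_sgrad// angG_famS famSE.
by rewrite powR_double powR_subn// expr_div_n.
Qed.

(** [energy_boundary] with its twelve analytic quantities abstracted, so that all their closed forms
    are substituted at once through [eq_boundary_form]. *)
Definition boundary_form (t lp sl dsl g0 dg0 g1 dg1 f0 f1 f2 f3 f4 : R) : R :=
    (k + 2) / 2 * lp ^+ 2
  - t ^+ 5 * f4 * f1
  + 2 * t ^+ 5 * f3 * f2
  - (delta1 n p - 6) * t ^+ 4 * f3 * f1
  - (24 - 6 * delta1 n p + delta2 n p) * t ^+ 3 * f2 * f1
  - (9 * delta1 n p - 3 * delta2 n p - 36) * t ^+ 2 * f1 ^+ 2
  + (delta1 n p - 8) * t ^+ 4 * f2 ^+ 2
  + delta4 n p * t * f0 * f1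
  + 2 * delta4 n p * f0 ^+ 2
  + 2 * sl ^+ 2
  + 2^-1 * t * dsl
  - 4 * (beta n p - n%:R + 4) * g0
  - (beta n p - n%:R + 4) * t * dg0
  - 6 * t ^+ 2 * g1
  + t ^+ 3 * dg1.

Let eq_boundary_form t a1 a2 a3 a4 a5 a6 a7 a8 a9 a10 a11 a12
    b1 b2 b3 b4 b5 b6 b7 b8 b9 b10 b11 b12 :
  a1 = b1 -> a2 = b2 -> a3 = b3 -> a4 = b4 -> a5 = b5 -> a6 = b6 -> a7 = b7 ->
  a8 = b8 -> a9 = b9 -> a10 = b10 -> a11 = b11 -> a12 = b12 ->
  boundary_form t a1 a2 a3 a4 a5 a6 a7 a8 a9 a10 a11 a12 =
  boundary_form t b1 b2 b3 b4 b5 b6 b7 b8 b9 b10 b11 b12.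
Proof. by do 12 move=> ->. Qed.

Lemma energy_boundaryE t y : 0 < t -> S y ->
  energy_boundary p u x t y = t `^ (2 * k) * bdry_sfn p v (t *: y).
Proof.
move=> t0 Sy; have tn : t != 0 by rewrite gt_eqF.
(* [scaled] and [dscaled] at order 0 are convertible, so the general lemma applies with [m = 0]. *)
have d0 : derive1 (fun s => enorm (sgrad (scaled p u x s) y) ^+ 2) t = _ :=
  derive_sqr_sgrad 0 t0 Sy.
have d1 := derive_sqr_sgrad 1 t0 Sy.
have g0 : enorm (sgrad (scaled p u x t) y) ^+ 2 = _ := enorm_sgrad_dscaled 0 t0 Sy.
have g1 := enorm_sgrad_dscaled 1 t0 Sy.
have s1 := derive_sqr_slaplacian t0 Sy.
have s0 : slaplacian (scaled p u x t) y = t `^ k * angL (V 0) (t *: y).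
  by rewrite scaledE slaplacian_sfn// angL_famS.
have l0 : laplacian (scaled p u x t) y = t `^ k * nlap (V 0) (t *: y).
  by rewrite scaledE laplacian_sphere// nlap_famS.
have f_ m := dscaled_val m y t0.
have -> : energy_boundary p u x t y = _ := eq_boundary_form t l0 s0 s1 g0 d0 g1 d1
  (f_ 0) (f_ 1) (f_ 2) (f_ 3) (f_ 4).
rewrite /boundary_form powR_double; set z := t *: y.
have -> : bdry_sfn p v z =
  (k + 2) / 2 * (nlap (V 0) z * nlap (V 0) z)
  + (- 1 * (V 4 z * V 1 z)
  + (2 * (V 3 z * V 2 z)
  + ((6 - delta1 n p) * (V 3 z * V 1 z)
  + (- (24 - 6 * delta1 n p + delta2 n p) * (V 2 z * V 1 z)
  + (- (9 * delta1 n p - 3 * delta2 n p - 36) * (V 1 z * V 1 z)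
  + ((delta1 n p - 8) * (V 2 z * V 2 z)
  + (delta4 n p * (V 0 z * V 1 z)
  + (2 * delta4 n p * (V 0 z * V 0 z)
  + (2 * (angL (V 0) z * angL (V 0) z)
  + (1 * (angL (V 0) z * angL (V 1) z)
  + (- 4 * (beta n p - n%:R + 4) * angG (V 0) (V 0) z
  + (- 2 * (beta n p - n%:R + 4) * angG (V 0) (V 1) z
  + (- 6 * angG (V 1) (V 1) z
  + 2 * angG (V 1) (V 2) z))))))))))))) by [].
move: (V 0 z) (V 1 z) (V 2 z) (V 3 z) (V 4 z) (nlap (V 0) z) (angL (V 0) z)
  (angL (V 1) z) (angG (V 0) (V 0) z) (angG (V 0) (V 1) z) (angG (V 1) (V 1) z)
  (angG (V 1) (V 2) z) (t `^ k) (delta1 n p) (delta2 n p) (delta4 n p) (beta n p).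
by move=> *; field.
Qed.

End boundary.

(** * The bulk density and its flux *)

Section bulk.
Context (R : realType) (n : nat) (p : R) (v : sfn R n).
Local Notation sfn := (sfn R n).
Local Notation k := (kexp p).
Local Notation V := (V p v).
Local Notation psi := (lap (lap (lap v))).
Hypothesis p1 : 1 < p.
Hypothesis vE : forall y, psi y = - (`|v y| `^ (p - 1) * v y).

Lemma is_derive_powR_norm (r : R) : r != 0 ->
  is_derive r 1 (fun s : R => `|s| `^ (p - 1) * s) (p * `|r| `^ (p - 1)).
Proof.
have pos (s : R) : 0 < s -> is_derive s 1 (fun s : R => `|s| `^ (p - 1) * s) (p * `|s| `^ (p - 1)).
  move=> s0; have H := is_deriveM (is_derive1_powR (p - 1) s0) (is_derive_id s 1).
  apply: (@is_derive_near_pos _ _ _ _ _ _ s0); last first.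
    apply: (is_derive_eq H).
    rewrite gtr0_norm// /GRing.scale/= -[p - 1 - 1]/(p - 1 - 1%:R) powR_subn// expr1.
    by field; rewrite gt_eqF.
  by move=> z z0; rewrite gtr0_norm.
move=> r0; have [rp|rn|/eqP] := ltgtP r 0; last by rewrite (negPf r0).
  have rp' : 0 < - r by rewrite oppr_gt0.
  have H := @is_derive1_comp R _ (fun s => - s) r _ _ (pos _ rp') (is_deriveNid r 1).
  have := is_deriveN H => {}H.
  rewrite (_ : (fun s => _) = - ((fun s : R => `|s| `^ (p - 1) * s) \o -%R)).
    by apply: (is_derive_eq H); rewrite normrN; ring.
  by apply/funext => s; rewrite /GRing.opp/= normrN mulrN opprK.
exact: pos.
Qed.

(** The factor [v] settles the zeros of [v], where [psi] vanishes too and both sides are 0.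
    Elsewhere it is the chain rule for [|s|^(p-1) s], with derivative [p |s|^(p-1)]. *)
Lemma pd_psi i : v * pd i psi = cstf p * (psi * pd i v).
Proof.
apply/sfnP => y; rewrite !sfnME cstfE vE.
have [v0|v0] := eqVneq (v y) 0; first by rewrite v0; ring.
have Hpsi := @is_derive_pderiv_line _ _ psi i y 0 (smooth_sfn psi).
have Hv := @is_derive_pderiv_line _ _ v i y 0 (smooth_sfn v).
have v0' : v (y + 0 *: delta_mx ord0 i) != 0 by rewrite scale0r addr0.
have H := @is_derive1_comp R _ (fun s => v (y + s *: delta_mx ord0 i)) 0 _ _
  (is_derive_powR_norm v0') Hv.
have {}H := is_deriveN H.
have E : (fun s : R => psi (y + s *: delta_mx ord0 i)) =
   - ((fun s : R => `|s| `^ (p - 1) * s) \o (fun s => v (y + s *: delta_mx ord0 i))).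
  by apply/funext => s; rewrite vE.
have := @derive_val _ _ _ _ _ _ _ Hpsi.
rewrite E (@derive_val _ _ _ _ _ _ _ H) scale0r addr0.
rewrite -[pderiv i psi y]/(pd i psi y) -[pderiv i v y]/(pd i v y) => <-.
by ring.
Qed.

Lemma euler_psi : v * euler psi = cstf p * (psi * euler v).
Proof.
rewrite /euler !mulr_sumr; apply: eq_bigr => i _.
by rewrite mulrCA pd_psi; ring.
Qed.

(** By the equation [v * psi] is [- |v|^(p+1)], whence the plus sign. In this form the density is
    visibly smooth, and the nonlinearity stays inside the ring [sfn]. *)
Definition bulk_sfn : sfn :=
  cstf 2^-1 * gdot (lap v) (lap v) + cstf (p + 1)^-1 * (v * psi).

(** What remains under a divergence when the Laplacians are moved from [V 1] to [v]. Its divergence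
    [gdot (lap (V 1)) (lap v) + V 1 * psi] is the first variation of the bulk energy in the
    direction [V 1], the generator of the scaling. *)
Definition flux_field (i : 'I_n) : sfn :=
  lap (V 1) * pd i (lap v) - lap (lap v) * pd i (V 1) + V 1 * pd i (lap (lap v)).

Lemma V1 : V 1 = cstf k * v + euler v.
Proof. by rewrite VS V0 subr0. Qed.

Lemma theta_bulk : theta (2 * k + 6) bulk_sfn = div flux_field.
Proof.
have -> : div flux_field = gdot (lap (V 1)) (lap v) + V 1 * psi.
  rewrite /div /flux_field.
  transitivity (\sum_(i < n) (pd i (lap (V 1)) * pd i (lap v) + lap (V 1) * pd i (pd i (lap v))
     - lap (lap v) * pd i (pd i (V 1)) + V 1 * pd i (pd i (lap (lap v))))).
    by apply: eq_bigr => i _; rewrite pdD pdB !pdM; ring.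
  rewrite !(big_split, sumrN)/= -!mulr_sumr.
  rewrite -[\sum_(i < n) pd i (pd i (V 1))]/(lap (V 1)).
  rewrite -[\sum_(i < n) pd i (pd i (lap v))]/(lap (lap v)).
  rewrite -[\sum_(i < n) pd i (pd i (lap (lap v)))]/psi.
  by rewrite -/(gdot _ _); ring.
(* This is where the value of [k] matters: the gradient term and the power term have the same
   scaling weight. *)
have k0 : (p + 1) * k = 2 * k + 6.
  by rewrite /kexp; field; rewrite subr_eq0 gt_eqF.
have c1 : cstf (p + 1)^-1 * cstf (p + 1) = 1 :> sfn.
  have pn : p + 1 != 0 by rewrite gt_eqF// addr_gt0// (lt_trans ltr01 p1).
  by rewrite -rmorphM/= mulVf// rmorph1.
have c2 : cstf 2^-1 * 2 = 1 :> sfn.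
  by rewrite -(rmorph_nat (@cstf R n) 2) -rmorphM/= mulVf ?rmorph1.
have lV : lap (V 1) = cstf (k + 2) * lap v + euler (lap v).
  by rewrite V1 raddfD/= lap_cstfM lap_euler; ring.
have gV : gdot (lap (V 1)) (lap v) = cstf (k + 2) * gdot (lap v) (lap v)
    + gdot (euler (lap v)) (lap v).
  by rewrite lV gdotDl gdot_cstfMl.
rewrite thetaD !theta_cstfM gV /theta.
rewrite eulerM euler_psi euler_gdot [gdot _ (euler _)]gdotC V1 -k0.
set g := gdot (lap v) (lap v); set g' := gdot (euler _) _.
have -> : cstf 2^-1 * (cstf ((p + 1) * k) * g + (g' + g' - 2 * g)) =
  (cstf 2^-1 * 2) * ((cstf (k + 2)) * g + g').
  by rewrite k0; ring.
have -> : cstf (p + 1)^-1 * (cstf ((p + 1) * k) * (v * psi) + (euler v * psi + cstf p * (psi * euler v))) =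
  (cstf (p + 1)^-1 * cstf (p + 1)) * ((cstf k * v + euler v) * psi).
  by ring.
by rewrite c1 c2; ring.
Qed.

Lemma radial_flux_field : radial flux_field =
  lap (V 1) * euler (lap v) - lap (lap v) * euler (V 1) + V 1 * euler (lap (lap v)).
Proof.
rewrite /radial /flux_field.
transitivity (\sum_(i < n) (lap (V 1) * (xcoord i * pd i (lap v))
   - lap (lap v) * (xcoord i * pd i (V 1)) + V 1 * (xcoord i * pd i (lap (lap v))))).
  by apply: eq_bigr => i _; ring.
by rewrite !(big_split, sumrN)/= -!mulr_sumr.
Qed.

(** Moving [rho2] across D D + (n - 2) D + L replaces D by D - 2 and leaves L unchanged; expanding
    gives the coefficients n - 6 and 8 - 2 n of [bilap]. *)
Lemma bilap_rho2 : bilap p v = rho2 R n ^+ 2 * lap (lap v).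
Proof.
have -> : rho2 R n ^+ 2 * lap (lap v) = rho2 R n * nlap (lap v) by rewrite /nlap; ring.
rewrite euler_angLE /bilap V0 /nlap angL_rho2 !(eulerM, eulerD, euler_rho2, euler_nat).
by ring.
Qed.

Lemma flux_rho2 : flux p v = rho2 R n ^+ 2 * radial flux_field.
Proof.
rewrite /flux bilap_rho2 radial_flux_field /nlap V0 expr2.
by rewrite !(eulerM, euler_rho2); ring.
Qed.

End bulk.

(** * Differentiating the energy *)

Section energy_derivative.
Context (R : realType) (n : nat) (p : R) (u : 'rV[R]_n -> R) (x : 'rV[R]_n).
Hypotheses (p1 : 1 < p) (su : smooth u).
Hypothesis uE : forall y : 'rV[R]_n,
  iter 3 (@neg_laplacian R n) u y = `|u y| `^ (p - 1) * u y.
Local Notation sfn := (sfn R n).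
Local Notation k := (kexp p).
Local Notation leb := (lebesgue_rV R n).
Local Notation sig := (sphere_measure R n).
Local Notation B := (eball (0 : 'rV[R]_n) 1).
Local Notation S := (usphere R n).
Let U : sfn := mksfn su.
Let v : sfn := trans x U.
Local Notation V := (V p v).
Local Notation IS f := (\int[sig]_(y in S) f y).
Local Notation IB f := (\int[leb]_(y in B) f y).
Implicit Types (y : 'rV[R]_n) (t l : R).

(** The two parts of [sgrad] have different weights: [pd i] gains a factor [t] by the chain rule and
    has weight [a + 1], while [euler] keeps the weight [a]. They are differentiated separately; [E1]
    and [E2] then recombine them into [V m.+1]. *)
Lemma is_derive_sgrad_dscaled m l y : 0 < l ->
  is_derive l 1 (fun t => sgrad (dscaled p u x m t) y) (sgrad (dscaled p u x m.+1 l) y).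
Proof.
move=> l0; apply: is_derive_rV => i.
pose a := k - m%:R.
have H1 := is_derive_famS (a + 1) (pd i (V m)) y l0.
have H2 := is_derive_famS a (euler (V m)) y l0.
have H3 := is_deriveM H2 (is_derive_cst (y ord0 i) l 1).
have H := is_deriveB H1 H3.
apply: (is_derive_near_pos l0 _ (is_derive_eq H _)).
  move=> s s0; rewrite dscaledE// sgrad_sfnE sfnBE sfnME -/a.
  transitivity (famS (a + 1) (pd i (V m)) s y - famS a (euler (V m)) s y * y ord0 i); last by [].
  rewrite famS_succ// /famS pd_cstfM pd_dil euler_cstfM euler_dil.
  by rewrite mulrCA.
have E1 : pd i (V m.+1) = theta (a + 1) (pd i (V m)).
  by rewrite VS -/a /theta pdD pd_cstfM pd_euler; ring.
have E2 : euler (V m.+1) = theta a (euler (V m)).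
  by rewrite VS -/a /theta eulerD euler_cstfM.
have Ea : k - m.+1%:R = a - 1%:R by rewrite -natr1 opprD addrA.
rewrite dscaledE// sgrad_sfnE sfnBE sfnME Ea.
rewrite /famS pd_cstfM pd_dil euler_cstfM euler_dil E1 E2.
set X1 := theta (a + 1) _; set X2 := theta a _.
transitivity (l^-1 * (l `^ (a + 1%:R) * X1 (l *: y)) -
  (l `^ a * euler (V m) (l *: y) * 0 + y ord0 i * (l^-1 * (l `^ a * X2 (l *: y))))); first by [].
transitivity (l `^ (a - 1%:R) * (l * X1 (l *: y)) - l `^ (a - 1%:R) * X2 (l *: y) * y ord0 i);
  last by [].
rewrite powR_addn// powR_subn// expr1.
by field; rewrite gt_eqF.
Qed.

Lemma lap3_trans y : lap (lap (lap v)) y = - (`|v y| `^ (p - 1) * v y).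
Proof.
rewrite /v !lap_trans !transE -[U _]/(u (x + y)) -uE.
have negE (f : sfn) : neg_laplacian f = (- lap f) :> (_ -> _).
  by apply/funext => z; rewrite /neg_laplacian laplacian_sfn.
have -> : iter 3 (@neg_laplacian R n) u = neg_laplacian (neg_laplacian (neg_laplacian U)) by [].
rewrite (negE U) (negE (- lap U)) (negE (- lap (- lap U))).
have lapN (f : sfn) : lap (- f) = - lap f by exact: raddfN.
by rewrite !lapN !opprK.
Qed.

Lemma eball_integral (f : sfn) t : 0 < t ->
  \int[leb]_(y in eball x t) f y = t ^+ n * IB (dil t (trans x f)).
Proof.
move=> t0; have mb : measurable (eball x t) by exact: measurable_eball.
have E1 := eball_affine x t (@ltr01 R); rewrite mul1r in E1.
have fb : (leb (eball x t) < +oo)%E.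
  have := lebesgue_rV_affine x (@ltr01 R) mb.
  rewrite E1 invr1 expr1n mul1e => <-; exact: lebesgue_eball_lty.
have [C [_ HC]] := enorm_bounded_continuous t (@sfn_continuous _ _ (trans x f)).
have If : leb.-integrable (eball x t) (EFin \o f).
  apply: (bounded_integrable mb fb (C := C)).
    by apply: continuous_measurable_rV; exact: sfn_continuous.
  move=> y yt; have := HC (y - x); rewrite transE [x + _]addrC subrK; apply.
  exact: ltW.
rewrite (@Rintegral_affine _ _ x t)//; last first.
  by apply: continuous_measurable_rV; exact: sfn_continuous.
by have := eball_affine x 1 t0; rewrite mulr1 => ->.
Qed.

Lemma energy_bulkE t : 0 < t ->
  t `^ (6 * ((p + 1) / (p - 1)) - n%:R) *
    (\int[leb]_(y in eball x t) (2^-1 * enorm (grad (laplacian u) y) ^+ 2)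
     - (p + 1)^-1 * \int[leb]_(y in eball x t) (`|u y| `^ (p + 1))) =
  t `^ (2 * k + 6) * IB (dil t (bulk_sfn p v)).
Proof.
move=> t0.
have -> : \int[leb]_(y in eball x t) (2^-1 * enorm (grad (laplacian u) y) ^+ 2) =
    t ^+ n * IB (dil t (cstf 2^-1 * gdot (lap v) (lap v))).
  transitivity (\int[leb]_(y in eball x t) (cstf 2^-1 * gdot (lap U) (lap U)) y).
    apply: eq_Rintegral => y _.
    by rewrite -[u]/(sfn_val U) laplacian_sfn enorm_grad.
  rewrite eball_integral//; congr (_ * Rintegral _ _ (sfn_val (dil t _))).
  by rewrite /v !lap_trans gdot_trans; apply/sfnP.
have -> : \int[leb]_(y in eball x t) (`|u y| `^ (p + 1)) =
    t ^+ n * IB (dil t (cstf (- 1) * (v * lap (lap (lap v))))).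
  transitivity (\int[leb]_(y in eball x t) (cstf (- 1) * (U * lap (lap (lap U)))) y).
    apply: eq_Rintegral => y _.
    have := lap3_trans (y - x); rewrite /v !lap_trans !transE [x + _]addrC subrK => E.
    rewrite !sfnME cstfE E; have [u0|u0] := eqVneq (U y) 0.
      by rewrite -[u y]/(U y) u0 normr0 powR0 ?mul0r ?mulr0// gt_eqF// addr_gt0// (lt_trans ltr01 p1).
    rewrite -[u y]/(U y) (_ : p + 1 = (p - 1) + 2%:R); last by ring.
    rewrite powR_addn ?normr_gt0// real_normK ?num_real//; ring.
  rewrite eball_integral//; congr (_ * Rintegral _ _ (sfn_val (dil t _))).
  by apply/sfnP => y; rewrite !(transE, sfnME) /v !lap_trans.
have -> : 6 * ((p + 1) / (p - 1)) - n%:R = 2 * k + 6 - n%:R.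
  by rewrite /kexp; field; rewrite subr_eq0 gt_eqF.
rewrite powR_subn//.
have -> : dil t (bulk_sfn p v) = dil t (cstf 2^-1 * gdot (lap v) (lap v)) +
    cstf (- (p + 1)^-1) * dil t (cstf (- 1) * (v * lap (lap (lap v)))).
  by rewrite /bulk_sfn rmorphD/=; congr (_ + _); rewrite !rmorphM/= !dil_const; ring.
rewrite ball_sfnD ball_sfnZ.
have tn : t ^+ n != 0 by rewrite expf_neq0// gt_eqF.
have pn : p + 1 != 0 by rewrite gt_eqF// addr_gt0// (lt_trans ltr01 p1).
by field; rewrite tn pn.
Qed.

(** The divergence theorem for the dilated field. Of the two factors [l], one comes from
    differentiating a dilation and the other from the coordinate in [radial]. *)
Lemma ball_dil_div (F : 'I_n -> sfn) l : 0 < l ->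
  IB (dil l (div F)) = (l ^+ 2)^-1 * IS (dil l (radial F)).
Proof.
move=> l0; have ln : l != 0 by rewrite gt_eqF.
have D : div (fun i => dil l (F i)) = cstf l * dil l (div F).
  rewrite /div raddf_sum mulr_sumr; apply: eq_bigr => i _.
  by rewrite pd_dil.
have X : dil l (radial F) = cstf l * radial (fun i => dil l (F i)).
  rewrite /radial raddf_sum mulr_sumr; apply: eq_bigr => i _.
  by rewrite /= rmorphM/= dil_coord mulrA.
have := ball_divergence (fun i => dil l (F i)); rewrite D ball_sfnZ X sphere_sfnZ => <-.
by field.
Qed.

Lemma sphere_dil_rho2 (f : sfn) l :
  IS (dil l (rho2 R n ^+ 2 * f)) = l ^+ 4 * IS (dil l f).
Proof.
rewrite -sphere_sfnZ; apply: sphere_sfn_eq => y Sy.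
have -> : dil l (rho2 R n ^+ 2 * f) = cstf (l ^+ 4) * (rho2 R n * (rho2 R n * dil l f)).
  by rewrite rmorphM rmorphXn/= dil_rho2; ring.
by rewrite !sfnME usphere_rho2// cstfE !mul1r.
Qed.

Let dilD (f g : sfn) l : dil l (f + g) = dil l f + dil l g.
Proof. exact: raddfD. Qed.

Let dilZ (c : R) (f : sfn) l : dil l (cstf c * f) = cstf c * dil l f.
Proof. by rewrite rmorphM/= dil_const. Qed.

Lemma sphere_dil_green (f g : sfn) l : IS (dil l (g * angL f + angG g f)) = 0.
Proof.
have -> : dil l (g * angL f + angG g f) = dil l g * angL (dil l f) + angG (dil l g) (dil l f).
  by rewrite rmorphD rmorphM/= -angL_dil -angG_dil.
exact: sphere_green.
Qed.

Lemma sphere_dil_sym (f g : sfn) l : IS (dil l (g * angL f - f * angL g)) = 0.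
Proof.
have -> : dil l (g * angL f - f * angL g) = dil l g * angL (dil l f) - dil l f * angL (dil l g).
  by rewrite rmorphB !rmorphM/= -!angL_dil; ring.
exact: sphere_angL_sym.
Qed.

Lemma is_derive_energy l : 0 < l ->
  is_derive l 1 (fun t => energy p u x t)
    (l^-1 * (l `^ (2 * k) * IS (dil l (diss_sfn p v)))).
Proof.
move=> l0.
have H1 := is_derive_famS_integral (2 * k + 6) (bulk_sfn p v)
  (@measurable_eball0 R n 1) (lebesgue_eball_lty n 1) (@eball_le _ _ _) l0.
have H2 := is_derive_famS_integral (2 * k) (bdry_sfn p v)
  (@measurable_usphere R n) (@sphere_measure_lty R n) (@usphere_le R n) l0.
have H := is_deriveD H1 H2.
apply: (is_derive_near_pos l0 _ (is_derive_eq H _)).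
  move=> t t0; rewrite /energy energy_bulkE//; congr (_ + _).
  rewrite -(RintegralZl _ _ _) //; last 2 first.
  - exact: measurable_usphere.
  - apply: sfn_integrable; [exact: measurable_usphere|exact: sphere_measure_lty|].
    exact: usphere_le.
  by apply: eq_Rintegral => y; rewrite inE => Sy; rewrite energy_boundaryE.
rewrite (theta_bulk p1 lap3_trans) ball_dil_div//.
(* The six extra powers of [l] are used up, two by the divergence theorem and four by the factor
   [rho2 ^+ 2] in [flux], so bulk and boundary terms end with the same weight. *)
have -> : l `^ (2 * k + 6) * ((l ^+ 2)^-1 * IS (dil l (radial (flux_field p v)))) =
    l `^ (2 * k) * IS (dil l (flux p v)).
  rewrite flux_rho2 sphere_dil_rho2 (powR_addn (2 * k) 6)//.
  by field; rewrite gt_eqF.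
rewrite -!mulrDr; congr (_ * (_ * _)).
have G j i c : IS (dil l (cstf c * green_sfn p v j i)) = 0.
  by rewrite dilZ sphere_sfnZ /green_sfn sphere_dil_green mulr0.
have Y j i c : IS (dil l (cstf c * sym_sfn p v j i)) = 0.
  by rewrite dilZ sphere_sfnZ /sym_sfn sphere_dil_sym mulr0.
have Y1 : sym_sfn p v 1 1 = cstf 1 * sym_sfn p v 1 1 by rewrite rmorph1 mul1r.
have Z f g : IS (dil l f) = 0 -> IS (dil l g) = 0 -> IS (dil l (f + g)) = 0.
  by move=> f0 g0; rewrite dilD sphere_sfnD f0 g0 addr0.
rewrite -sphere_sfnD -dilD monotonicity_identity Y1 dilD sphere_sfnD.
rewrite [X in _ + X](_ : _ = 0) ?addr0//.
exact: Z _ _ (Z _ _ (Z _ _ (Z _ _ (Z _ _ (Z _ _ (Z _ _ (Z _ _ (Z _ _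
  (G _ _ _) (G _ _ _)) (G _ _ _)) (G _ _ _)) (G _ _ _)) (G _ _ _)) (G _ _ _))
  (Y _ _ _)) (Y _ _ _)) (Y _ _ _).
Qed.

Lemma sphere_integral_scaled (h : 'rV[R]_n -> R) (f : sfn) l :
  (forall y, S y -> h y = l^-1 * l `^ (2 * k) * f (l *: y)) ->
  IS h = l^-1 * (l `^ (2 * k) * IS (dil l f)).
Proof.
move=> hE; rewrite mulrA -sphere_sfnZ; apply: eq_Rintegral => y.
by rewrite inE => /hE ->.
Qed.

(** A squared derivative of order [m] in the radius has the weight [2 * k - 2 * m] and comes with
    the explicit power [2 * m - 1] of [l]; every term thus has the common factor [l^-1] times [l] to
    the power [2 * k]. *)
Lemma sphere_dissipation l : 0 < l ->
  l^-1 * (l `^ (2 * k) * IS (dil l (diss_sfn p v))) =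
  IS (fun y =>
    2 * l ^+ 5 * dscaled p u x 3 l y ^+ 2
    + (10 * delta1 n p - 2 * delta2 n p - 56) * l ^+ 3 * dscaled p u x 2 l y ^+ 2
    + (- 18 * delta1 n p + 6 * delta2 n p - 4 * delta3 n p
         + 2 * delta4 n p + 72) * l * dscaled p u x 1 l y ^+ 2)
  + IS (fun y =>
    4 * l ^+ 3 * enorm (derive1n 2 (fun t : R => sgrad (scaled p u x t) y) l) ^+ 2
    + (8 * alpha n p - 4 * beta n p + 4 * n%:R - 28) * l
        * enorm (derive1 (fun t : R => sgrad (scaled p u x t) y) l) ^+ 2)
  + 2 * l * IS (fun y => derive1 (fun t : R => slaplacian (scaled p u x t) y) l ^+ 2)
  + l * IS (fun y => derive1 (fun t : R => laplacian (scaled p u x t) y) l ^+ 2).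
Proof.
move=> l0; have ln : l != 0 by rewrite gt_eqF.
have sg1 s y : 0 < s -> derive1 (fun t : R => sgrad (scaled p u x t) y) s
    = sgrad (dscaled p u x 1 s) y.
  move=> s0; rewrite derive1E.
  exact: (@derive_val _ _ _ _ _ _ _ (is_derive_sgrad_dscaled 0 y s0)).
have sg2 y : derive1n 2 (fun t : R => sgrad (scaled p u x t) y) l
    = sgrad (dscaled p u x 2 l) y.
  rewrite derive1nS derive1n1 derive1E.
  exact: (@derive_val _ _ _ _ _ _ _
    (is_derive_near_pos l0 (fun s => @sg1 s y) (is_derive_sgrad_dscaled 1 y l0))).
set c1 := 10 * _ - _ - _; set c2 := - 18 * _ + _ - _ + _ + _; set c3 := 8 * _ - _ + _ - _.
rewrite [X in _ = X + _ + _ + _](@sphere_integral_scaled _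
  (cstf 2 * V 3 ^+ 2 + cstf c1 * V 2 ^+ 2 + cstf c2 * V 1 ^+ 2) l);
  last first.
  move=> y Sy; rewrite !(dscaled_val p x su)// powR_double.
  set z := l *: y; rewrite -[RHS]/(l^-1 * l `^ k ^+ 2 * (2 * (V 3 z * V 3 z) + c1 * (V 2 z * V 2 z)
    + c2 * (V 1 z * V 1 z))).
  by move: (V 3 z) (V 2 z) (V 1 z) => a b c; field.
rewrite [X in _ = _ + X + _ + _](@sphere_integral_scaled _
  (cstf 4 * angG (V 2) (V 2) + cstf c3 * angG (V 1) (V 1)) l);
  last first.
  move=> y Sy; rewrite sg2 (sg1 l y l0).
  rewrite powR_double.
  transitivity (4 * l ^+ 3 * (l `^ k ^+ 2 / l ^+ 2 ^+ 2 * angG (V 2) (V 2) (l *: y))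
    + c3 * l * (l `^ k ^+ 2 / l ^+ 1 ^+ 2 * angG (V 1) (V 1) (l *: y))).
    by congr (4 * l ^+ 3 * _ + c3 * l * _); exact: enorm_sgrad_dscaled.
  set z := l *: y; rewrite -[RHS]/(l^-1 * l `^ k ^+ 2 * (4 * angG (V 2) (V 2) z + c3 * angG (V 1) (V 1) z)).
  by move: (angG (V 2) (V 2) z) (angG (V 1) (V 1) z) => a b; field.
have -> : IS (fun y => derive1 (fun t : R => slaplacian (scaled p u x t) y) l ^+ 2) =
    l^-1 ^+ 2 * l `^ (2 * k) * IS (dil l (angL (V 1) ^+ 2)).
  rewrite -sphere_sfnZ; apply: eq_Rintegral => y; rewrite inE => Sy.
  rewrite derive1E (@derive_val _ _ _ _ _ _ _ (derive_slaplacian_scaled p x su l0 Sy)).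
  rewrite sfnME cstfE dilE sfnXE powR_double.
  by move: (angL _ _) => a; ring.
have -> : IS (fun y => derive1 (fun t : R => laplacian (scaled p u x t) y) l ^+ 2) =
    l^-1 ^+ 2 * l `^ (2 * k) * IS (dil l (nlap (V 1) ^+ 2)).
  rewrite -sphere_sfnZ; apply: eq_Rintegral => y; rewrite inE => Sy.
  rewrite (derive_laplacian_scaled p x su l0 Sy).
  rewrite sfnME cstfE dilE sfnXE powR_double.
  by move: (nlap _ _) => a; ring.
set D1 : sfn := cstf 2 * V 3 ^+ 2 + _ + _; set D2 : sfn := cstf 4 * _ + _.
have -> : IS (dil l (diss_sfn p v)) = IS (dil l D1) + IS (dil l D2)
    + 2 * IS (dil l (angL (V 1) ^+ 2)) + IS (dil l (nlap (V 1) ^+ 2)).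
  rewrite -[diss_sfn p v]/(D1 + D2 + cstf 2 * angL (V 1) ^+ 2 + nlap (V 1) ^+ 2).
  by rewrite (dilD (D1 + D2 + _)) (dilD (D1 + D2)) (dilD D1) dilZ !sphere_sfnD sphere_sfnZ.
move: (IS _) (IS _) (IS _) (IS _) (l `^ _) => i1 i2 i3 i4 P.
by field.
Qed.

End energy_derivative.

Theorem theorem2p1 (R : realType) (n : nat) (p : R) (u : 'rV[R]_n -> R)
    (x : 'rV[R]_n) :
  1 < p ->
  smooth u ->
  (forall y : 'rV[R]_n,
     iter 3 (@neg_laplacian R n) u y = `|u y| `^ (p - 1) * u y) ->
  forall l : R, 0 < l ->
  is_derive l 1 (fun t : R => energy p u x t)
    (\int[sphere_measure R n]_(y in usphere R n)
       (2 * l ^+ 5 * dscaled p u x 3 l y ^+ 2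
        + (10 * delta1 n p - 2 * delta2 n p - 56) * l ^+ 3
            * dscaled p u x 2 l y ^+ 2
        + (- 18 * delta1 n p + 6 * delta2 n p - 4 * delta3 n p
             + 2 * delta4 n p + 72) * l * dscaled p u x 1 l y ^+ 2)
     + \int[sphere_measure R n]_(y in usphere R n)
       (4 * l ^+ 3
            * enorm (derive1n 2 (fun t : R => sgrad (scaled p u x t) y) l) ^+ 2
        + (8 * alpha n p - 4 * beta n p + 4 * n%:R - 28) * l
            * enorm (derive1 (fun t : R => sgrad (scaled p u x t) y) l) ^+ 2)
     + 2 * l * \int[sphere_measure R n]_(y in usphere R n)
         (derive1 (fun t : R => slaplacian (scaled p u x t) y) l ^+ 2)
     + l * \int[sphere_measure R n]_(y in usphere R n)
         (derive1 (fun t : R => laplacian (scaled p u x t) y) l ^+ 2)).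
Proof.
move=> p1 su uE l l0; apply: (is_derive_eq (is_derive_energy x p1 su uE l0)).
exact: sphere_dissipation.
Qed.
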